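(* Let $\min\{H_1,\dots,H_N\}>\frac14$ and let $\mathbb{M}$ be the geometric rough path above the $\mathbb{R}^d$-valued generalized mixed fractional Brownian motion $M_t^H(a)=\sum_{k=1}^Na_kB_t^{H_k}$, $t\in[0,T]$. Then the signature $S(\mathbb{M})_{0,T}$ converges in the $p$-variation topology for any $p>\frac{1}{\min\{H_k\}}$. Moreover, $S(\mathbb{M})_{s,t}$ is a group-like element in the tensor algebra and satisfies Chen's identity $$S(\mathbb{M})_{s,u}=S(\mathbb{M})_{s,t}\otimes S(\mathbb{M})_{t,u}\qquad\text{for all }0\le s\le t\le u\le T.$$
   Context: Here $N\ge1$, $H\in(0,1)^N$, $a\in\mathbb{R}^N\setminus\{0\}$, and $B^{H_1},\dots,B^{H_N}$ are independent; each $B^{H_k}$ is an $\mathbb{R}^d$-valued fractional Brownian motion with independent components of Hurst parameter $H_k$. Let $t_l^m=l2^{-m}T$ and let $M^m$ be the continuous path agreeing with $M$ at all $t_l^m$ and affine between consecutive ones; let $\mathbb{M}^m$ be its smooth rough path, with $k$-th level $\int_{s<u_1<\cdots<u_k<t}dM^m_{u_1}\otimes\cdots\otimes dM^m_{u_k}$, $1\le k\le\lfloor p\rfloor$. $\mathbb{M}$ is the almost sure limit of $\mathbb{M}^m$ for the $p$-variation distance $d_p(X,Y)=\max_{1\le k\le\lfloor p\rfloor}\sup_{\mathcal D}\big(\sum_{[u,v]\in\mathcal D}|X^k_{u,v}-Y^k_{u,v}|^{p/k}\big)^{k/p}$ (supremum over partitions of $[0,T]$). The signature of $\mathbb{M}$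 over $[s,t]$ is the formal series $S(\mathbb{M})_{s,t}=\sum_{n=0}^\infty\int_{s<t_1<\cdots<t_n<t}d\mathbb{M}_{t_1}\otimes\cdots\otimes d\mathbb{M}_{t_n}\in T((\mathbb{R}^d))$, where $T((\mathbb{R}^d))$ is the space of formal tensor series and the iterated integrals are in the rough path sense: for $n\le\lfloor p\rfloor$ the $n$-th term is the $n$-th level of $\mathbb{M}$, and higher terms are given by Lyons' unique extension. ''Group-like'' means that the coordinates satisfy the shuffle relations $\langle v,S\rangle\langle w,S\rangle=\langle v\,\text{ш}\,w,S\rangle$ for all words $v,w$, with level-$0$ component $1$. *)

(* Defs.v *)
From HB Require Import structures.
From mathcomp Require Import all_boot all_order all_algebra.
From mathcomp Require Import all_classical all_reals all_analysis.

Set Implicit Arguments.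
Unset Strict Implicit.
Unset Printing Implicit Defensive.

Import Order.TTheory GRing.Theory Num.Theory.
Import numFieldNormedType.Exports.

Local Open Scope classical_set_scope.
Local Open Scope ring_scope.

(* T((R^d)): the series x is given by its coordinates <w, x> on the words w in
   the alphabet {0, ..., d-1}; its n-th level is its restriction to the words
   of length n. *)
Definition tseries (R : realType) (d : nat) := seq 'I_d -> R.

Definition tprod (R : realType) (d : nat) (x y : tseries R d) : tseries R d :=
  fun w => \sum_(i < (size w).+1) x (take i w) * y (drop i w).

Definition tunit (R : realType) (d : nat) : tseries R d :=
  fun w => (w == [::])%:R.

Definition level_norm (R : realType) (d k : nat) (x : tseries R d) : R :=
  Num.sqrt (\sum_(w : k.-tuple 'I_d) x w ^+ 2).

(* The shuffle product of two words is the sum of the words in this list, which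
   repeats a word as often as its multiplicity in the product. *)
Fixpoint shuffle (A : Type) (v : seq A) : seq A -> seq (seq A) :=
  if v is a :: v' then
    fix shuffle_v (w : seq A) : seq (seq A) :=
      if w is b :: w' then
        map (cons a) (shuffle v' w) ++ map (cons b) (shuffle_v w')
      else [:: v]
  else fun w => [:: w].

Definition group_like (R : realType) (d : nat) (x : tseries R d) : Prop :=
  x [::] = 1 /\ forall v w, x v * x w = \sum_(u <- shuffle v w) x u.

(* Two-parameter functionals X : R -> R -> tseries R d, with X s t the value on
   [s, t], are only meaningful for 0 <= s <= t <= T. *)

(* sup over the partitions 0 = u_0 < ... < u_r = T of
   (\sum_i |X^k_{u_i, u_(i+1)} - Y^k_{u_i, u_(i+1)}|^(p/k))^(k/p) *)
Definition pvar_dist (R : realType) (d : nat) (p T : R) (k : nat)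
    (X Y : R -> R -> tseries R d) : \bar R :=
  ereal_sup [set
    ((\sum_(0 <= i < size D)
       let u := nth T (0 :: D) i in let v := nth T (0 :: D) i.+1 in
       level_norm k (fun w => X u v w - Y u v w) `^ (p / k%:R))
     `^ (k%:R / p))%:E | D in itv_partition 0 T].

Definition pvar (R : realType) (d : nat) (p T : R) (k : nat)
    (X : R -> R -> tseries R d) : \bar R :=
  pvar_dist p T k X (fun _ _ _ => 0).

(* The distance d_p on p-rough paths is the case n = floor p. *)
Definition rp_dist (R : realType) (d : nat) (p T : R) (n : nat)
    (X Y : R -> R -> tseries R d) : \bar R :=
  \big[maxe/0%E]_(1 <= k < n.+1) pvar_dist p T k X Y.

Definition dyadic_interp (R : realType) (d : nat) (T : R) (m : nat)
    (x : R -> 'rV[R]_d) (t : R) : 'rV[R]_d :=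
  let h := T / 2 ^+ m in let l := Num.truncn (t / h) in
  x (l%:R * h) + (t / h - l%:R) *: (x (l.+1%:R * h) - x (l%:R * h)).

(* iter_int x s t [:: i_1; ...; i_n] is the integral of
   dx^{i_1}_{u_1} ... dx^{i_n}_{u_n} over s < u_1 < ... < u_n < t, the variable
   u_1 being the outermost one.  It is used for piecewise affine x, for which
   dx^i_u = (x^i)'(u) du; the value of the derivative at the finitely many
   points where the slope changes is irrelevant. *)
Fixpoint iter_int (R : realType) (d : nat) (x : R -> 'rV[R]_d) (s t : R)
    (w : seq 'I_d) : R :=
  if w is i :: w' then
    \int[lebesgue_measure]_(u in `[s, t])
      (derive1 (fun v => x v 0 i) u * iter_int x u t w')
  else 1.

Definition multiplicative_functional (R : realType) (d : nat) (T : R)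
    (S : R -> R -> tseries R d) : Prop :=
  [/\ forall s t, 0 <= s -> s <= t -> t <= T -> S s t [::] = 1,
      forall s t u, 0 <= s -> s <= t -> t <= u -> u <= T ->
        S s u = tprod (S s t) (S t u)
    & forall w, {within [set x : R * R | [&& 0 <= x.1, x.1 <= x.2 & x.2 <= T]],
        continuous (fun x : R * R => S x.1 x.2 w)}].

(* S is a signature of the p-rough path X, of which only the levels up to
   floor p are used: S is a continuous multiplicative functional of finite
   p-variation that extends X. *)
Definition lyons_extension (R : realType) (d : nat) (p T : R)
    (X S : R -> R -> tseries R d) : Prop :=
  [/\ multiplicative_functional T S,
      forall k, (0 < k)%N -> (pvar p T k S < +oo)%E
    & forall s t w, 0 <= s -> s <= t -> t <= T ->
        (size w <= Num.truncn p)%N -> S s t w = X s t w].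

(* normal_prob m s is not the Dirac mass at m when s = 0. *)
Definition gaussian_rv (disp : measure_display) (Omega : measurableType disp)
    (R : realType) (P : probability Omega R) (X : Omega -> R) : Prop :=
  exists m s : R, forall A : set R, measurable A ->
    P (X @^-1` A) = if s == 0 then dirac m A else normal_prob m s A.

Definition gaussian_process (disp : measure_display)
    (Omega : measurableType disp) (R : realType) (P : probability Omega R)
    (X : R -> Omega -> R) : Prop :=
  forall (n : nat) (t c : 'I_n -> R), (forall i, 0 <= t i) ->
    gaussian_rv P (fun omega => \sum_(i < n) c i * X (t i) omega).

(* Processes are indexed by R, but only times t >= 0 matter. *)
Definition is_fbm (disp : measure_display) (Omega : measurableType disp)
    (R : realType) (P : probability Omega R) (h : R)
    (X : R -> {RV P >-> R}) : Prop :=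
  [/\ gaussian_process P X,
      forall t, 0 <= t -> ('E_P[X t] = 0)%E,
      forall s t, 0 <= s -> 0 <= t ->
        covariance P (X s) (X t) =
        ((s `^ (2 * h) + t `^ (2 * h) - `|t - s| `^ (2 * h)) / 2)%:E
    & {ae P, forall omega,
        {within `[0, +oo[, continuous (fun t => X t omega)}}].

Definition generated_sigma (disp : measure_display)
    (Omega : measurableType disp) (R : realType) (I : Type) (D : set I)
    (X : I -> Omega -> R) : set_system Omega :=
  <<s \bigcup_(i in D) preimage_set_system setT (X i) measurable >>.

Definition mutually_independent (disp : measure_display)
    (Omega : measurableType disp) (R : realType) (P : probability Omega R)
    (I : finType) (F : I -> set_system Omega) : Prop :=
  forall (J : {set I}) (A : I -> set Omega), (forall i, i \in J -> F i (A i)) ->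
    P (\bigcap_(i in [set` J]) A i) = (\prod_(i in J) P (A i))%E.

(* Component j of B^{H_k} is B k j. *)
Definition fbm_family (disp : measure_display) (Omega : measurableType disp)
    (R : realType) (P : probability Omega R) (N d : nat) (H : 'rV[R]_N)
    (B : 'I_N -> 'I_d -> R -> {RV P >-> R}) : Prop :=
  [/\ forall k j, is_fbm (H 0 k) (B k j),
      forall k, mutually_independent P
        (fun j => generated_sigma [set t | 0 <= t] (fun t => B k j t : _ -> _))
    & mutually_independent P
        (fun k => generated_sigma [set jt : 'I_d * R | 0 <= jt.2]
                    (fun jt => B k jt.1 jt.2 : _ -> _))].

(* The default value 1 is harmless, since Hurst parameters are less than 1. *)
Definition min_hurst (R : realType) (N : nat) (H : 'rV[R]_N) : R :=
  \big[Num.min/1]_(k < N) H 0 k.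

Definition mixed_fbm (disp : measure_display) (Omega : measurableType disp)
    (R : realType) (P : probability Omega R) (N d : nat) (a : 'rV[R]_N)
    (B : 'I_N -> 'I_d -> R -> {RV P >-> R}) (omega : Omega) (t : R) :
    'rV[R]_d :=
  \row_(j < d) \sum_(k < N) a 0 k * B k j t omega.

(* MM is the almost sure limit, for d_p on [0, T], of the smooth rough paths of
   the dyadic interpolations of the process M.  The distance d_p sees neither
   level 0 nor the degenerate intervals [t, t]; on these MM takes the values
   common to all rough paths. *)
Definition geometric_rough_path_above (disp : measure_display)
    (Omega : measurableType disp) (R : realType) (P : probability Omega R)
    (d : nat) (p T : R) (M : Omega -> R -> 'rV[R]_d)
    (MM : Omega -> R -> R -> tseries R d) : Prop :=
  {ae P, forall omega,
    [/\ forall s t, 0 <= s -> s <= t -> t <= T -> MM omega s t [::] = 1,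
        forall t w, 0 <= t -> t <= T -> (size w <= Num.truncn p)%N ->
          MM omega t t w = tunit R w
      & rp_dist p T (Num.truncn p)
          (iter_int (dyadic_interp T m (M omega))) (MM omega)
        @[m --> \oo] --> 0%E]}.

(* Main.v *)
Require Import Defs.
From HB Require Import structures.
From mathcomp Require Import all_boot all_order all_algebra.
From mathcomp Require Import all_classical all_reals all_analysis.
From mathcomp Require Import measurable_realfun ring lra.

Set Implicit Arguments.
Unset Strict Implicit.
Unset Printing Implicit Defensive.

Import Order.TTheory GRing.Theory Num.Theory.
Import numFieldNormedType.Exports.

Local Open Scope classical_set_scope.
Local Open Scope ring_scope.

(* The argument is pathwise. The iterated integrals of a piecewise affine path
   form a multiplicative functional x with |x_{s,t}(w)| <= (L (t - s))^|w|.
   For such a functional the shuffle relations follow from Chen's identity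
   alone, by a first-order expansion in s. If two of them are bounded by a
   common control om at the levels up to floor p, and their difference by eps
   times that bound, then by induction on the level (Chen's identity makes
   x(w) almost additive, and the sewing lemma applies since |w| / p > 1) the
   same holds at every level n, with a constant of order K^n / (n!)^(1/p). All
   bounds are coordinatewise, so no tensor norm is needed.

   Applied to pairs of interpolations, with for om the p-variation of both and
   of their difference divided by eps, this shows that their signatures are
   Cauchy at every level; the limit S inherits Chen's identity, the shuffle
   relations and the decay in n.  Two extensions of the same rough path that
   agree below level n > p differ at level n by an additive continuous
   functional of finite (p / n)-variation with p / n < 1, hence not at all. *)

(** * Partition sums, controls and the sewing lemma *)

(** No bound uniform in m is available for the Lipschitz constants of the interpolations. Apart from
    one fixed interpolation, which serves to show that the limit has finite variation, these
    constants are kept out of all bounds: they only make x(w) of order (t - s)^2 when w has at least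
    two letters. Sums over fine partitions then vanish, and sewing bounds x(w) itself by a constant
    that involves the control alone.

    The control depends on the pair of interpolations and on eps, and need not converge. What is
    uniform is its total mass M on [0, T]. Hence the limit is estimated one partition at a time: the
    sum over a fixed partition is bounded through M first and passes to the limit afterwards.

    The induction on levels must not let its constant deteriorate. Bounding each term of Chen's sum
    by one term of the binomial formula would cost a factor equal to the number of terms. The weight
    k^-2 in [level_cst] absorbs this, being stable under convolution up to a factor 8; that factor
    and the sewing constant are absorbed by [level_beta]. *)

Section Sewing.
Context {R : realType}.
Implicit Types (phi A om : R -> R -> R) (s t u v : R) (D : seq R).

(** As in [itv_partition], the list holds the points after [s]; unlike there, repeated points are
    allowed. *)
Fixpoint vsum phi s D : R :=
  if D is t :: D' then phi s t + vsum phi t D' else 0.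

Lemma vsum_cat phi s D1 D2 :
  vsum phi s (D1 ++ D2) = vsum phi s D1 + vsum phi (last s D1) D2.
Proof. by elim: D1 s => [|t D1 IH] s /=; rewrite ?add0r// IH addrA. Qed.

Lemma vsum_nth phi x0 s D :
  \sum_(0 <= i < size D) phi (nth x0 (s :: D) i) (nth x0 (s :: D) i.+1) =
  vsum phi s D.
Proof.
elim: D s => [|t D IH] s /=; first by rewrite big_geq.
by rewrite big_nat_recl// -IH.
Qed.

Lemma path_le_last s D : path <=%O s D -> s <= last s D.
Proof.
elim: D s => //= t D IH s /andP[st /IH]; exact: le_trans.
Qed.

Lemma vsum_le phi phi' s T D : (forall u v, s <= u -> u <= v -> v <= T ->
    phi u v <= phi' u v) ->
  path <=%O s D -> last s D <= T -> vsum phi s D <= vsum phi' s D.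
Proof.
elim: D s => //= t D IH s H /andP[st tD] DT; apply: lerD.
  by apply: H => //; exact: le_trans (path_le_last tD) DT.
by apply: IH => // u v tu; apply: H; exact: le_trans tu.
Qed.

Lemma path_ltW s D : path <%O s D -> path <=%O s D.
Proof. by apply: sub_path => x y; exact: ltW. Qed.

Lemma vsum_ge0 phi s D :
  (forall u v, 0 <= phi u v) -> 0 <= vsum phi s D.
Proof. by move=> H; elim: D s => //= t D IH s; rewrite addr_ge0. Qed.

Lemma vsumD phi phi' s D :
  vsum (fun u v => phi u v + phi' u v) s D = vsum phi s D + vsum phi' s D.
Proof. elim: D s => /= [|t D IH] s; rewrite ?addr0// IH; ring. Qed.

Lemma vsumZ (c : R) phi s D :
  vsum (fun u v => c * phi u v) s D = c * vsum phi s D.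
Proof. by elim: D s => /= [|t D IH] s; rewrite ?mulr0// IH mulrDr. Qed.

Lemma vsum_sum (I : Type) (r : seq I) (phi : I -> R -> R -> R) s D :
  vsum (fun u v => \sum_(i <- r) phi i u v) s D =
  \sum_(i <- r) vsum (phi i) s D.
Proof.
elim: D s => /= [|t D IH] s; first by rewrite big1.
by rewrite IH big_split.
Qed.

Lemma vsum_sub s D : vsum (fun u v => v - u) s D = last s D - s.
Proof. elim: D s => /= [|t D IH] s; rewrite ?subrr// IH; ring. Qed.

(** Continuity is not asked for, so that the variation of any nonnegative function with bounded
    partition sums qualifies. *)
Record control (T : R) om : Prop := Control {
  control_ge0 : forall s t, 0 <= s -> s <= t -> t <= T -> 0 <= om s t;
  control_superadd : forall s t u, 0 <= s -> s <= t -> t <= u -> u <= T ->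
    om s t + om t u <= om s u }.

Lemma control_mono T om s t u v : control T om ->
  0 <= s -> s <= u -> u <= v -> v <= t -> t <= T -> om u v <= om s t.
Proof.
move=> [H0 H] s0 su uv vt tT.
have := H s u t s0 su (le_trans uv vt) tT.
have := H u v t (le_trans s0 su) uv vt tT.
have := H0 s u s0 su (le_trans (le_trans uv vt) tT).
have := H0 v t (le_trans s0 (le_trans su uv)) vt tT.
lra.
Qed.

Lemma control_diag T om s : control T om -> 0 <= s -> s <= T -> om s s = 0.
Proof.
move=> [H0 H] s0 sT.
have := H s s s s0 (lexx _) (lexx _) sT; have := H0 s s s0 (lexx _) sT; lra.
Qed.

Lemma control_vsum T om s D : control T om -> 0 <= s ->
  path <=%O s D -> last s D <= T -> vsum om s D <= om s (last s D).
Proof.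
move=> com; elim: D s => [|t D IH] s s0 /=.
  by move=> _ sT; rewrite (control_diag com).
move=> /andP[st tD] DT.
apply: le_trans (control_superadd com s0 st (path_le_last tD) DT).
by rewrite lerD2l IH// (le_trans s0).
Qed.

Definition var phi s t : R := sup [set vsum phi s D | D in itv_partition s t].

Section Var.
Variables (T M : R) (phi : R -> R -> R).
Hypothesis phi0 : forall u v, 0 <= phi u v.
Hypothesis phiM : forall D, itv_partition 0 T D -> vsum phi 0 D <= M.

(** At most two more intervals complete [D] to a partition of [0, T], and their terms are
    nonnegative. The case distinctions come from the strict increase that [itv_partition]
    demands. *)
Lemma vsum_bounded s t D : 0 <= s -> t <= T -> itv_partition s t D ->
  vsum phi s D <= M.
Proof.
move=> s0 tT Dst.
pose D0 := if 0 < s then [:: s] else [::].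
pose D1 := if t < T then [:: T] else [::].
have P0 : itv_partition 0 s D0.
  rewrite /D0; case: ltP => [|sle]; first exact: itv_partition1.
  by split => //=; rewrite eq_le s0 sle.
have P1 : itv_partition t T D1.
  rewrite /D1; case: ltP => [|tge]; first exact: itv_partition1.
  by split => //=; rewrite eq_le tT tge.
have := phiM (itv_partition_cat P0 (itv_partition_cat Dst P1)).
rewrite !vsum_cat; case: P0 => _ /eqP ->; apply: le_trans.
by rewrite addrCA lerDl addr_ge0// vsum_ge0.
Qed.

Let var_sup s t : 0 <= s -> s <= t -> t <= T ->
  has_sup [set vsum phi s D | D in itv_partition s t].
Proof.
move=> s0 st tT; split; last first.
  by exists M => _ [D Dst <-]; apply: vsum_bounded Dst.
move: st; rewrite le_eqVlt => /orP[/eqP <-|st].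
  by exists 0, [::] => //=; split => //=.
by exists (vsum phi s [:: t]), [:: t] => //; exact: itv_partition1.
Qed.

Lemma control_var : control T (var phi).
Proof.
have le_var s t D : 0 <= s -> t <= T -> itv_partition s t D ->
    vsum phi s D <= var phi s t.
  move=> s0 tT Dst; apply: (sup_upper_bound (var_sup s0 _ tT)).
    exact: itv_partition_le Dst.
  by exists D.
split=> [s t s0 st tT|s t u s0 st tu uT].
  have [[_ [D Dst _]] _] := var_sup s0 st tT.
  by apply: le_trans (le_var _ _ _ s0 tT Dst); exact: vsum_ge0.
have t0 := le_trans s0 st; have tT := le_trans tu uT.
rewrite -lerBrDr; apply: ge_sup; first by case: (var_sup s0 st tT).
move=> _ [D Dst <-]; rewrite lerBrDr addrC -lerBrDr.
apply: ge_sup; first by case: (var_sup t0 tu uT).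
move=> _ [D' Dtu <-]; rewrite lerBrDr addrC.
have -> : vsum phi s D + vsum phi t D' = vsum phi s (D ++ D').
  by rewrite vsum_cat; case: Dst => _ /eqP ->.
by apply: le_var => //; exact: itv_partition_cat Dst Dtu.
Qed.

(** Strictness matters: the only partition of [s, s] is empty, so [var phi s s] is 0 whatever
    [phi s s] is. *)
Lemma le_var s t : 0 <= s -> s < t -> t <= T -> phi s t <= var phi s t.
Proof.
move=> s0 st tT; apply: (sup_upper_bound (var_sup s0 (ltW st) tT)).
by exists [:: t]; [exact: itv_partition1|rewrite /= addr0].
Qed.

Lemma var_le : 0 <= T -> var phi 0 T <= M.
Proof.
move=> T0; apply: ge_sup; first by case: (var_sup (lexx 0) T0 (lexx T)).
by move=> _ [D DT <-]; exact: phiM.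
Qed.

End Var.

(** The point [c] is the first one at which the control counted from [s] exceeds half of the total,
    or the last point if there is none. By superadditivity at most half is left after [c]. *)
Lemma control_split T om s D : control T om -> 0 <= s -> D != [::] ->
  path <=%O s D -> last s D <= T ->
  exists D1 c D2, [/\ D = D1 ++ c :: D2,
    om s (last s D1) <= om s (last s D) / 2 &
    om c (last c D2) <= om s (last s D) / 2].
Proof.
move=> com s0 Dnil sD DT; set W := om s _.
have W0 : 0 <= W by apply: (control_ge0 com) => //; exact: path_le_last.
have H D1 D2 : D = D1 ++ D2 -> D2 != [::] -> om s (last s D1) <= W / 2 ->
  exists D1 c D2, [/\ D = D1 ++ c :: D2,
    om s (last s D1) <= W / 2 & om c (last c D2) <= W / 2].
  elim: D2 D1 => // c D2 IH D1 DE _ D1W.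
  have cat_last : last c D2 = last s D by rewrite DE last_cat.
  have /and3P[sD1 D1c cD2] : [&& path <=%R s D1, last s D1 <= c & path <=%R c D2].
    by move: sD; rewrite DE cat_path.
  have sc : s <= c by apply: le_trans D1c; exact: path_le_last.
  have cT : c <= last s D by rewrite -cat_last path_le_last.
  have [cW|cW] := leP (om s c) (W / 2); last first.
    exists D1, c, D2; split=> //; rewrite cat_last.
    have := control_superadd com s0 sc cT DT; rewrite -/W; lra.
  case: D2 DE cat_last cD2 IH => [|c' D2] DE cat_last cD2 IH; last first.
    by apply: (IH (rcons D1 c)); rewrite ?cat_rcons// last_rcons.
  exists D1, c, [::]; split=> //=; rewrite (control_diag com) ?divr_ge0//.
    exact: le_trans sc.
  by move: DT; rewrite -cat_last.
by apply: (H [::] D) => //=; rewrite (control_diag com) ?divr_ge0//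
  (le_trans (path_le_last sD)).
Qed.

(** The solution of C = 2 + 2^(1 - th) C: cutting a partition by [control_split] costs two
    additivity defects and leaves two shorter partitions, each with at most half of the control. *)
Definition sewing_const (th : R) : R := 2 / (1 - 2 `^ (1 - th)).

Lemma powR2_lt1 (th : R) : 1 < th -> 2 `^ (1 - th) < 1 :> R.
Proof.
move=> th1; rewrite /powR pnatr_eq0/= expR_lt1.
by rewrite nmulr_rlt0 ?subr_lt0// ln_gt0// ltr1n.
Qed.

Lemma sewing_const_ge0 th : 1 < th -> 0 <= sewing_const th.
Proof. by move=> th1; rewrite divr_ge0// subr_ge0 ltW// powR2_lt1. Qed.

Lemma sewing_const_le th th' : 1 < th -> th <= th' ->
  sewing_const th' <= sewing_const th.
Proof.
move=> th1 thth'; have th'1 := lt_le_trans th1 thth'.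
rewrite ler_pM2l// lef_pV2 ?posrE ?subr_gt0 ?powR2_lt1// lerD2l lerN2.
by apply: ler_powR; rewrite ?ler1n// lerD2l lerN2.
Qed.

Section SewingLemma.
Variables (T kappa th : R) (om A : R -> R -> R).
Hypothesis th1 : 1 < th.
Hypothesis kappa0 : 0 <= kappa.
Hypothesis com : control T om.
Hypothesis Adiag : forall s, 0 <= s -> s <= T -> A s s = 0.
Hypothesis Adelta : forall s t u, 0 <= s -> s <= t -> t <= u -> u <= T ->
  `|A s u - A s t - A t u| <= kappa * om s u `^ th.

(** Strong induction on the number of points. [control_split] sets one interval apart, and the
    induction hypothesis handles the pieces on both sides of it; the bound does not depend on the
    partition. *)
Lemma sewing s D : 0 <= s -> path <=%O s D -> last s D <= T ->
  `|A s (last s D) - vsum A s D| <=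
    kappa * sewing_const th * om s (last s D) `^ th.
Proof.
have [n] := ubnP (size D); elim: n s D => // n IH s D + s0 sD DT.
have [->|Dnil] := eqVneq D [::] => sizeD.
  have sT : s <= T := le_trans (path_le_last sD) DT.
  rewrite /= Adiag// subr0 normr0 mulr_ge0 ?powR_ge0//.
  by rewrite mulr_ge0// sewing_const_ge0.
have [D1 [c [D2 [DE D1W D2W]]]] := control_split com s0 Dnil sD DT.
move: sD DT sizeD D1W D2W; rewrite {Dnil}DE last_cat cat_path/=.
set l := last s D1; set t := last c D2; set W := om s t.
have th0 : 0 <= th by rewrite (le_trans ler01)// ltW.
move=> /and3P[sD1 lc cD2] tT; rewrite size_cat/= addnS ltnS => sizeD D1W D2W.
have sl : s <= l := path_le_last sD1.
have ct : c <= t := path_le_last cD2.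
have lt := le_trans lc ct; have lT := le_trans lt tT.
have l0 := le_trans s0 sl; have c0 := le_trans l0 lc.
have sc := le_trans sl lc; have st := le_trans sl lt.
have W0 : 0 <= W by exact: (control_ge0 com).
set C := sewing_const th; have C0 : 0 <= C := sewing_const_ge0 th1.
have half (x y : R) : 0 <= x -> x <= y -> y <= T -> om x y <= W / 2 ->
    kappa * C * om x y `^ th <= kappa * C * (2 `^ (- th) * W `^ th).
  move=> x0 xy yT omW; apply: ler_wpM2l; first by rewrite mulr_ge0.
  have -> : 2 `^ (- th) * W `^ th = (W / 2) `^ th.
    by rewrite powRM// mulrC -(powR_inv1 (ler0n _ 2)) -powRrM mulN1r.
  apply: ge0_ler_powR; rewrite ?nnegrE ?divr_ge0//.
  exact: (control_ge0 com).
have E1 := le_trans (IH s D1 (leq_ltn_trans (leq_addr _ _) sizeD) s0 sD1 lT)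
  (half _ _ s0 sl lT D1W).
have E2 := le_trans (IH c D2 (leq_ltn_trans (leq_addl _ _) sizeD) c0 cD2 tT)
  (half _ _ c0 ct tT D2W).
have E3 := Adelta s0 sc ct tT.
have E4 : `|A s c - A s l - A l c| <= kappa * W `^ th.
  apply: le_trans (Adelta s0 sl lc (le_trans ct tT)) _.
  apply: ler_wpM2l => //; apply: ge0_ler_powR; rewrite ?nnegrE//.
    by apply: (control_ge0 com) => //; exact: le_trans tT.
  exact: (control_mono com).
have CE : C = 2 + C * (2 * 2 `^ (- th)).
  have -> : 2 * 2 `^ (- th) = 2 `^ (1 - th) :> R.
    by rewrite powRD ?powRr1// ?pnatr_eq0 ?implybT.
  rewrite /C /sewing_const; field.
  by rewrite subr_eq0 eq_sym lt_eqF// powR2_lt1.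
rewrite vsum_cat/= -/l.
have -> : A s t - (vsum A s D1 + (A l c + vsum A c D2)) =
  (A s t - A s c - A c t) + (A s c - A s l - A l c) +
  (A s l - vsum A s D1) + (A c t - vsum A c D2) by ring.
apply: le_trans (ler_normD _ _) _.
apply: le_trans (lerD (ler_normD _ _) (lexx _)) _.
apply: le_trans (lerD (lerD (ler_normD _ _) (lexx _)) (lexx _)) _.
apply: le_trans (lerD (lerD (lerD E3 E4) E1) E2) _.
rewrite [X in _ <= _ * X * _]CE -/W.
rewrite le_eqVlt; apply/orP; left; apply/eqP; ring.
Qed.

End SewingLemma.

(** Bisection: two intervals of half the length have together half the sum of squares. *)
Lemma fine_partition s t j : s <= t -> exists D,
  [/\ path <=%O s D, last s D = t &
      vsum (fun u v => (v - u) ^+ 2) s D <= (t - s) ^+ 2 / 2 ^+ j].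
Proof.
elim: j s t => [|j IH] s t st.
  by exists [:: t]; rewrite /= st addr0 expr0 divr1.
pose m := (s + t) / 2.
have [|D1 [sD1 lD1 vD1]] := IH s m; first by rewrite /m; lra.
have [|D2 [sD2 lD2 vD2]] := IH m t; first by rewrite /m; lra.
exists (D1 ++ D2); rewrite cat_path last_cat vsum_cat lD1 sD1 sD2 lD2.
split=> //; apply: le_trans (lerD vD1 vD2) _.
rewrite /m [2 ^+ j.+1]exprS invfM le_eqVlt; apply/orP; left; apply/eqP; field.
by rewrite expf_neq0.
Qed.

Lemma le_geometric_eps (x y C : R) :
  (forall j, x <= y + C / 2 ^+ j) -> x <= y.
Proof.
move=> H; apply: (@ler_cvg_to _ \oo _ _ (fun=> x) (fun j => y + C / 2 ^+ j)).
- exact: cvg_cst.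
- rewrite -[X in _ --> X]addr0 -(mulr0 C); apply: cvgD; first exact: cvg_cst.
  apply: cvgM; first exact: cvg_cst.
  rewrite (_ : (fun j => _) = (fun j => 2^-1 ^+ j)); last first.
    by apply/funext => j; rewrite exprVn.
  by apply: cvg_expr; rewrite ger0_norm ?invr_ge0// invf_lt1// ltr1n.
- by near=> j; exact: H.
Unshelve. all: by end_near.
Qed.

(* The sum over a partition vanishes in the limit, the increments being
   quadratically small. *)
Lemma sewing_quadratic T kappa th C om A : 1 < th -> 0 <= kappa ->
  control T om ->
  (forall s t u, 0 <= s -> s <= t -> t <= u -> u <= T ->
    `|A s u - A s t - A t u| <= kappa * om s u `^ th) ->
  (forall s t, 0 <= s -> s <= t -> t <= T -> `|A s t| <= C * (t - s) ^+ 2) ->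
  forall s t, 0 <= s -> s <= t -> t <= T ->
  `|A s t| <= kappa * sewing_const th * om s t `^ th.
Proof.
move=> th1 kappa0 com Adelta AC s t s0 st tT.
have Adiag u : 0 <= u -> u <= T -> A u u = 0.
  move=> u0 uT; apply/eqP; rewrite -normr_le0.
  by apply: le_trans (AC u u u0 (lexx _) uT) _; rewrite subrr expr0n mulr0.
have C0 D : path <=%O s D -> last s D <= T ->
    `|vsum A s D| <= C * vsum (fun u v => (v - u) ^+ 2) s D.
  elim: D s {st} s0 => [|x D IH] s s0 /=; first by rewrite normr0 mulr0.
  move=> /andP[sx xD] DT; apply: le_trans (ler_normD _ _) _.
  rewrite mulrDr lerD ?AC ?IH// ?(le_trans s0)//.
  exact: le_trans (path_le_last xD) DT.
apply: (@le_geometric_eps _ _ (`|C| * (t - s) ^+ 2)) => j.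
have [D [sD lD vD]] := fine_partition j st.
have := sewing th1 kappa0 com Adiag Adelta s0 sD; rewrite lD => /(_ tT) H.
rewrite -[A s t](subrK (vsum A s D)); apply: le_trans (ler_normD _ _) _.
apply: lerD => //; apply: le_trans (C0 D sD _) _; first by rewrite lD.
rewrite -mulrA; apply: le_trans (ler_wpM2l _ vD); last by [].
apply: ler_wpM2r; last exact: ler_norm.
by elim: (D) (s) => //= x E IH y; rewrite addr_ge0// sqr_ge0.
Qed.

End Sewing.

(** * Lipschitz multiplicative functionals *)

Section LipschitzFunctional.
Context {R : realType} {d : nat}.
Implicit Types (x y : R -> R -> tseries R d) (s t u T L : R) (v w : seq 'I_d).

Record lipschitz_mf T L x : Prop := LipschitzMf {
  lmf_ge0 : 0 <= L;
  lmf_nil : forall s t, 0 <= s -> s <= t -> t <= T -> x s t [::] = 1;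
  lmf_chen : forall s t u, 0 <= s -> s <= t -> t <= u -> u <= T ->
    x s u = tprod (x s t) (x t u);
  lmf_le : forall s t w, 0 <= s -> s <= t -> t <= T ->
    `|x s t w| <= (L * (t - s)) ^+ size w }.

Lemma tprod_cons (x1 x2 : tseries R d) a w : x1 [::] = 1 ->
  tprod x1 x2 (a :: w) =
  x2 (a :: w) + \sum_(i < (size w).+1) x1 (a :: take i w) * x2 (drop i w).
Proof. by move=> x1nil; rewrite /tprod/= big_ord_recl/= x1nil mul1r. Qed.

(** The form in which Chen's identity is used for sewing: the middle sum is the additivity defect,
    and it involves only nonempty words shorter than [w]. *)
Lemma tprod_mid (x1 x2 : tseries R d) w n : x1 [::] = 1 -> x2 [::] = 1 ->
  size w = n.+1 -> tprod x1 x2 w =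
  x2 w + \sum_(i < n) x1 (take i.+1 w) * x2 (drop i.+1 w) + x1 w.
Proof.
move=> x1nil x2nil wn; rewrite /tprod wn big_ord_recl big_ord_recr/=.
rewrite take0 drop0 x1nil mul1r.
by rewrite [take (bump _ _) w]take_oversize ?drop_oversize ?wn// x2nil mulr1 addrA.
Qed.

Section FixedFunctional.
Variables (T L : R) (x : R -> R -> tseries R d).
Hypothesis xL : lipschitz_mf T L x.

Lemma lmf_bounded s t w : 0 <= s -> s <= t -> t <= T ->
  `|x s t w| <= (L * T) ^+ size w.
Proof.
move=> s0 st tT; apply: le_trans (lmf_le xL w s0 st tT) _.
have L0 := lmf_ge0 xL.
by rewrite lerXn2r ?nnegrE ?mulr_ge0 ?ler_wpM2l//; lra.
Qed.

Lemma lmf_diag s a w : 0 <= s -> s <= T -> x s s (a :: w) = 0.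
Proof.
move=> s0 sT; apply/eqP; rewrite -normr_le0.
by apply: le_trans (lmf_le xL _ s0 _ sT) _; rewrite // subrr mulr0 /= expr0n.
Qed.

Lemma lmf_quadratic s t w : 0 <= s -> s <= t -> t <= T -> (1 < size w)%N ->
  `|x s t w| <= L ^+ size w * T ^+ (size w - 2) * (t - s) ^+ 2.
Proof.
move=> s0 st tT w2; apply: le_trans (lmf_le xL w s0 st tT) _.
rewrite exprMn -mulrA; apply: ler_wpM2l; first by rewrite exprn_ge0// (lmf_ge0 xL).
rewrite -{1}(subnK w2) exprD; apply: ler_wpM2r; first exact: sqr_ge0.
by rewrite lerXn2r ?nnegrE; lra.
Qed.

(** The constant may depend on the Lipschitz constant and is not tracked; only the order in [s' - s]
    matters. *)
Definition small t (e : R -> R -> R) := exists C, forall s s',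
  0 <= s -> s <= s' -> s' <= t -> `|e s s'| <= C * (s' - s) ^+ 2.

Lemma smallD t e1 e2 : small t e1 -> small t e2 ->
  small t (fun s s' => e1 s s' + e2 s s').
Proof.
move=> [C1 H1] [C2 H2]; exists (C1 + C2) => s s' s0 ss' s't.
rewrite mulrDl; apply: le_trans (ler_normD _ _) _.
by apply: lerD; [exact: H1|exact: H2].
Qed.

Lemma small_bounded t e1 e2 : small t e1 ->
  (exists B, forall s s', 0 <= s -> s <= s' -> s' <= t -> `|e2 s s'| <= B) ->
  small t (fun s s' => e1 s s' * e2 s s').
Proof.
move=> [C H] [B HB]; exists (C * B) => s s' s0 ss' s't.
by rewrite normrM mulrAC; apply: ler_pM => //; [exact: H|exact: HB].
Qed.

Lemma small_sum t (I : Type) (r : seq I) (e : I -> R -> R -> R) :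
  (forall i, small t (e i)) -> small t (fun s s' => \sum_(i <- r) e i s s').
Proof.
move=> H; elim: r => [|i r IH].
  by exists 0 => *; rewrite big_nil normr0 mul0r.
have [C HC] := smallD (H i) IH; exists C => *.
by rewrite big_cons; exact: HC.
Qed.

(** The terms of Chen's identity that put at least two letters on [s, s'] are quadratically small.
    This stands for the differential equation in [s] that iterated integrals satisfy. *)
Lemma lmf_first_order t a w : t <= T ->
  small t (fun s s' =>
    x s t (a :: w) - x s' t (a :: w) - x s s' [:: a] * x s' t w).
Proof.
move=> tT.
have E s s' : 0 <= s -> s <= s' -> s' <= t ->
    x s t (a :: w) - x s' t (a :: w) - x s s' [:: a] * x s' t w =
    \sum_(i < size w) x s s' (a :: take i.+1 w) * x s' t (drop i.+1 w).
  move=> s0 ss' s't; rewrite (lmf_chen xL s0 ss' s't tT).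
  rewrite tprod_cons; last by rewrite (lmf_nil xL)// (le_trans s't).
  rewrite big_ord_recl/= take0 drop0; ring.
pose C (i : 'I_(size w)) :=
  L ^+ i.+2 * T ^+ i * (L * T) ^+ (size w - i.+1).
exists (\sum_i C i) => s s' s0 ss' s't; rewrite E//.
apply: le_trans (ler_norm_sum _ _ _) _; rewrite mulr_suml.
apply: ler_sum => i _; rewrite normrM.
have sz : size (a :: take i.+1 w) = i.+2 by rewrite /= size_takel.
rewrite /C mulrAC; apply: ler_pM => //.
  have := @lmf_quadratic s s' (a :: take i.+1 w) s0 ss' (le_trans s't tT).
  by rewrite sz subSS subn1/=; exact.
by rewrite -size_drop; apply: lmf_bounded => //; exact: le_trans ss'.
Qed.

(* Differentiated in s to first order, the two sides of the shuffle relation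
   follow the recursion defining the shuffle product; the errors are quadratic
   in the increment of s, hence vanish. *)
Lemma lmf_shuffle s t v w : 0 <= s -> s <= t -> t <= T ->
  x s t v * x s t w = \sum_(u <- shuffle v w) x s t u.
Proof.
move=> s0 st tT; have t0 := le_trans s0 st.
have [n] := ubnP (size v + size w)%N; elim: n v w s s0 st => // n IH.
case=> [|a v] [|b w] s s0 st; rewrite ltnS.
- by move=> _; rewrite /= big_seq1 (lmf_nil xL)// mulr1.
- by move=> _; rewrite /= big_seq1 (lmf_nil xL)// mul1r.
- by move=> _; rewrite /= big_seq1 (lmf_nil xL)// mulr1.
move=> vwn'; have vwn : ((size v + size w).+1 < n)%N.
  by move: vwn'; rewrite /= addSn addnS.
have shE : shuffle (a :: v) (b :: w) =
  map (cons a) (shuffle v (b :: w)) ++ map (cons b) (shuffle (a :: v) w) by [].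
have IH1 r : 0 <= r -> r <= t ->
    x r t v * x r t (b :: w) = \sum_(u <- shuffle v (b :: w)) x r t u.
  by move=> *; apply: IH; rewrite //= addnS.
have IH2 r : 0 <= r -> r <= t ->
    x r t (a :: v) * x r t w = \sum_(u <- shuffle (a :: v) w) x r t u.
  by move=> *; apply: IH; rewrite //= addSn.
rewrite {}shE; move: (shuffle v _) (shuffle _ w) IH1 IH2.
move=> U1 U2 IH1 IH2.
pose f r := x r t (a :: v) * x r t (b :: w) -
            \sum_(u <- map (cons a) U1 ++ map (cons b) U2) x r t u.
(* Every word involved has a first letter, so all terms vanish on the degenerate interval. *)
have ft : f t = 0.
  rewrite /f big_cat !big_map/= !big1 ?addr0 => [|u _|u _];
  by rewrite ?lmf_diag// ?mul0r ?subrr.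
suff fs : f s = 0 by apply/eqP; rewrite -subr_eq0; apply/eqP.
have bnd r (u : seq 'I_d) : 0 <= r -> r <= t -> `|x r t u| <= (L * T) ^+ size u.
  by move=> *; exact: lmf_bounded.
have bnd2 r r' (u : seq 'I_d) : 0 <= r -> r <= r' -> r' <= t ->
    `|x r r' u| <= (L * T) ^+ size u.
  by move=> r0 rr' r't; apply: lmf_bounded => //; exact: le_trans tT.
pose rem (c : 'I_d) (u : seq 'I_d) := fun r r' =>
  x r t (c :: u) - x r' t (c :: u) - x r r' [:: c] * x r' t u.
have remS c (u : seq 'I_d) : small t (rem c u) := lmf_first_order c u tT.
have [C fC] : small t (fun r r' => f r - f r').
  pose S1 := fun r r' => \sum_(u <- U1) rem a u r r'.
  pose S2 := fun r r' => \sum_(u <- U2) rem b u r r'.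
  (* A discrete Leibniz rule. The terms linear in the one-letter increments cancel against the two
     halves of the shuffle by [IH1] and [IH2]; what remains is a product of two such increments and
     multiples of remainders. *)
  pose e r r' := (x r r' [:: a] * x r r' [:: b]) * (x r' t v * x r' t w) +
    rem a v r r' * x r t (b :: w) +
    rem b w r r' * (x r' t (a :: v) + x r r' [:: a] * x r' t v) +
    S1 r r' * (- 1) + S2 r r' * (- 1).
  have fE r r' : 0 <= r -> r <= r' -> r' <= t -> f r - f r' = e r r'.
    move=> r0 rr' r't; rewrite /e /S1 /S2 /rem /f !big_cat !big_map/=.
    rewrite !big_split !sumrN/= -!mulr_sumr -IH1 -?IH2 ?(le_trans r0)//; ring.
  have [C HC] : small t e; last first.
    by exists C => r r' r0 rr' r't; rewrite fE//; exact: HC.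
  apply: smallD; last first.
    by apply: small_bounded; [exact: small_sum|exists 1 => *; rewrite normrN1].
  apply: smallD; last first.
    by apply: small_bounded; [exact: small_sum|exists 1 => *; rewrite normrN1].
  apply: smallD; last first.
    apply: small_bounded => //.
    exists ((L * T) ^+ size (a :: v) + (L * T) ^+ 1 * (L * T) ^+ size v).
    move=> r r' r0 rr' r't; apply: le_trans (ler_normD _ _) _.
    have r'0 := le_trans r0 rr'; apply: lerD; first exact: bnd.
    by rewrite normrM; apply: ler_pM => //; [exact: (@bnd2 r r' [:: a])|exact: bnd].
  apply: smallD; last first.
    apply: small_bounded => //; exists ((L * T) ^+ size (b :: w)).
    by move=> r r' r0 rr' r't; apply: bnd => //; exact: le_trans r't.
  apply: small_bounded; last first.
    exists ((L * T) ^+ size v * (L * T) ^+ size w) => r r' r0 rr' r't.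
    have r'0 := le_trans r0 rr'.
    by rewrite normrM; apply: ler_pM => //; exact: bnd.
  exists (L ^+ 2) => r r' r0 rr' r't.
  rewrite normrM -exprMn expr2; apply: ler_pM => //.
    by have := lmf_le xL [:: a] r0 rr' (le_trans r't tT).
  by have := lmf_le xL [:: b] r0 rr' (le_trans r't tT).
(* The increments of [f] are exactly additive, so sewing applies with [kappa = 0], the zero control
   and the exponent 2. *)
have com : control t (fun _ _ => 0 : R) by split=> *; rewrite ?addr0.
have := @sewing_quadratic R t 0 2 C _ (fun r r' => f r - f r')
  (ltr1n R 2) (lexx _) com _ fC s t s0 st (lexx _).
rewrite !mul0r normr_le0 subr_eq0 ft => H; apply/eqP; apply: H => r r' r'' *.
by rewrite (_ : _ - _ = 0) ?normr0 ?mul0r//; ring.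
Qed.

End FixedFunctional.

End LipschitzFunctional.

(** * Factorial decay and continuity of the extension *)

Section LevelBounds.
Context {R : realType} {d : nat}.
Implicit Types (w : seq 'I_d) (s t u : R).

Lemma powR_exprn (a r : R) n : 0 <= a -> (a `^ r) ^+ n = (a ^+ n) `^ r.
Proof. by move=> a0; rewrite -!powR_mulrn ?powR_ge0// powRAC. Qed.

(** Telescoping, through the sharper bound 2 - 1/n for n > 0. *)
Lemma sum_inv_sqr n : \sum_(i < n) (i.+1%:R ^- 2 : R) <= 2.
Proof.
case: n => [|n]; first by rewrite big_ord0.
suff H : \sum_(i < n.+1) (i.+1%:R ^- 2 : R) <= 2 - n.+1%:R^-1.
  by apply: le_trans H _; rewrite gerBl invr_ge0.
elim: n => [|n IH]; first by rewrite big_ord1 expr1n invr1; lra.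
rewrite big_ord_recr/=; apply: le_trans (lerD IH (lexx _)) _.
have n1 : 0 < n.+1%:R :> R by rewrite ltr0n.
have n2 : 0 < n.+2%:R :> R by rewrite ltr0n.
rewrite -addrA lerD2l -lerBrDl opprK addrC.
have -> : n.+1%:R^-1 - n.+2%:R^-1 = (n.+1%:R * n.+2%:R)^-1 :> R.
  rewrite -[n.+2%:R]natr1; move: (n.+1%:R : R) n1 => x x0; field.
  by rewrite !gt_eqF ?addr_gt0.
by rewrite lef_pV2 ?posrE ?mulr_gt0 ?exprn_gt0// expr2 ler_pM2r// ler_nat.
Qed.

(** With a = i + 1 and b = n - i, so that a + b = n + 1, the inequality (a + b)^2 <= 2 (a^2 + b^2)
    separates the two factors. *)
Lemma sum_inv_sqr_conv n :
  \sum_(i < n) ((i.+1%:R ^+ 2 * (n - i)%:R ^+ 2)^-1 : R) <= 8 / n.+1%:R ^+ 2.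
Proof.
have H (i : 'I_n) : (i.+1%:R ^+ 2 * (n - i)%:R ^+ 2)^-1 <=
    2 / n.+1%:R ^+ 2 * (i.+1%:R ^- 2 + (n - i)%:R ^- 2) :> R.
  have a0 : 0 < i.+1%:R :> R by rewrite ltr0n.
  have b0 : 0 < (n - i)%:R :> R by rewrite ltr0n subn_gt0.
  have -> : n.+1%:R = i.+1%:R + (n - i)%:R :> R.
    by rewrite -natrD addSn subnKC// ltnW.
  move: (i.+1%:R : R) ((n - i)%:R : R) a0 b0 => a b a0 b0.
  have -> : 2 / (a + b) ^+ 2 * (a ^- 2 + b ^- 2) =
      (a ^+ 2 * b ^+ 2)^-1 * (2 * (a ^+ 2 + b ^+ 2) / (a + b) ^+ 2).
    by field; rewrite ?gt_eqF ?addr_gt0.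
  apply: ler_peMr; first by rewrite invr_ge0 mulr_ge0 ?sqr_ge0.
  rewrite ler_pdivlMr ?exprn_gt0 ?addr_gt0//.
  by rewrite mul1r -subr_ge0; apply: le_trans (sqr_ge0 (a - b)) _; lra.
apply: le_trans (ler_sum _ (fun i _ => H i)) _.
rewrite -mulr_sumr big_split/= (_ : 8 = 2 * (2 + 2)); last by ring.
rewrite [X in _ <= X]mulrAC; apply: ler_wpM2l; first by rewrite divr_ge0// exprn_ge0.
apply: lerD; first exact: sum_inv_sqr.
rewrite (reindex_inj rev_ord_inj)/=; apply: le_trans (sum_inv_sqr n).
by apply: ler_sum => i _; rewrite subKn.
Qed.

Variable p : R.
Hypothesis p1 : 1 < p.

Let p0 : 0 < p. Proof. exact: lt_trans p1. Qed.
Let ip0 : 0 <= p^-1. Proof. by rewrite invr_ge0 ltW. Qed.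

(** Stands for the factorial of k / p in Lyons' estimate. With a root of an integer factorial, the
    ordinary binomial formula suffices. *)
Definition fact_root k : R := (k`!)%:R `^ p^-1.

Lemma fact_root_gt0 k : 0 < fact_root k.
Proof. by rewrite powR_gt0// ltr0n fact_gt0. Qed.

(* A single term of the binomial formula; it replaces the neo-classical
   inequality. *)
Lemma binomial_root (a b : R) n k : 0 <= a -> 0 <= b -> (k <= n)%N ->
  (a `^ p^-1) ^+ k * (b `^ p^-1) ^+ (n - k) / (fact_root k * fact_root (n - k))
  <= ((a + b) `^ p^-1) ^+ n / fact_root n.
Proof.
move=> a0 b0 kn; have f0 := fact_root_gt0.
rewrite ler_pdivrMr ?mulr_gt0// mulrAC ler_pdivlMr//.
rewrite !powR_exprn ?addr_ge0// /fact_root -!powRM ?exprn_ge0 ?mulr_ge0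
  ?exprn_ge0 ?addr_ge0//.
apply: ge0_ler_powR; rewrite ?nnegrE ?mulr_ge0 ?exprn_ge0 ?addr_ge0//.
rewrite -(bin_fact kn) !natrM mulrA.
apply: ler_wpM2r; first by rewrite mulr_ge0.
rewrite addrC exprDn (bigD1 (Ordinal (leq_ltn_trans kn (ltnSn n))))//=.
rewrite mulr_natr [b ^+ _ * _]mulrC lerDl sumr_ge0// => i _.
by rewrite mulrn_wge0// mulr_ge0 ?exprn_ge0.
Qed.

(** The sewing exponent at the first level above floor p; it is the smallest one, hence the one with
    the largest sewing constant. *)
Definition level_theta : R := (Num.truncn p).+1%:R / p.

Lemma level_theta_gt1 : 1 < level_theta.
Proof. by rewrite ltr_pdivlMr// mul1r truncnS_gt. Qed.

(** Here 16 is the 8 of [sum_inv_sqr_conv] times 2, as the defect of a difference of two functionals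
    has two terms per splitting of the word. The summand 1 makes positivity immediate. *)
Definition level_beta : R := 1 + 16 * sewing_const level_theta.

Lemma level_beta_gt0 : 0 < level_beta.
Proof.
rewrite ltr_pwDl// mulr_ge0//; exact: sewing_const_ge0 level_theta_gt1.
Qed.

(** Large enough for [level_cst k] to be at least 1 at the levels 1 to floor p, where the induction
    starts. *)
Definition level_base : R := 1 +
  \sum_(k < (Num.truncn p).+1) fact_root k * level_beta * k%:R ^+ 2.

(** At k = 0 the inverse of zero makes this 0, so the estimates by [level_cst] are stated for
    nonempty words. *)
Definition level_cst k : R :=
  level_base ^+ k / (fact_root k * level_beta * k%:R ^+ 2).

Let sum_ge0 :
  0 <= \sum_(k < (Num.truncn p).+1) fact_root k * level_beta * k%:R ^+ 2.
Proof.
apply: sumr_ge0 => k _; have := fact_root_gt0 k; have := level_beta_gt0.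
by move=> /ltW ? /ltW ?; rewrite !mulr_ge0 ?sqr_ge0.
Qed.

Lemma level_base_ge1 : 1 <= level_base.
Proof. by rewrite lerDl. Qed.

Lemma level_cst_ge0 k : 0 <= level_cst k.
Proof.
have := fact_root_gt0 k; have := level_beta_gt0; have := level_base_ge1.
move=> K1 /ltW ? /ltW ?; rewrite divr_ge0 ?mulr_ge0 ?sqr_ge0 ?exprn_ge0//.
by rewrite (le_trans ler01).
Qed.

Lemma level_cst_ge1 k : (0 < k <= Num.truncn p)%N -> 1 <= level_cst k.
Proof.
move=> /andP[k0 kp]; rewrite ler_pdivlMr; last first.
  by rewrite !mulr_gt0 ?fact_root_gt0 ?level_beta_gt0 ?exprn_gt0 ?ltr0n.
rewrite mul1r; apply: (@le_trans _ _ level_base); last first.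
  by apply: ler_eXnr => //; exact: level_base_ge1.
have kp' : (k < (Num.truncn p).+1)%N by [].
rewrite /level_base (bigD1 (Ordinal kp'))//= addrCA lerDl addr_ge0//.
apply: sumr_ge0 => i _; have := fact_root_gt0 i; have := level_beta_gt0.
by move=> /ltW ? /ltW ?; rewrite !mulr_ge0 ?sqr_ge0.
Qed.

(* The convolution of the level constants is what the middle terms of Chen's
   identity at level n + 1 produce. *)
Lemma level_cst_conv (a b : R) n : 0 <= a -> 0 <= b ->
  \sum_(i < n) level_cst i.+1 * (a `^ p^-1) ^+ i.+1 *
      (level_cst (n - i) * (b `^ p^-1) ^+ (n - i)) <=
  8 / level_beta * level_cst n.+1 * ((a + b) `^ p^-1) ^+ n.+1.
Proof.
move=> a0 b0; have B0 := level_beta_gt0; have K1 := level_base_ge1.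
have K0 : 0 < level_base := lt_le_trans ltr01 K1.
set P := ((a + b) `^ p^-1) ^+ n.+1.
have P0 : 0 <= P by rewrite exprn_ge0 ?powR_ge0.
pose c := level_base ^+ n.+1 / level_beta ^+ 2 * (P / fact_root n.+1).
have c0 : 0 <= c.
  have F0 := ltW (fact_root_gt0 n.+1).
  by apply: mulr_ge0; apply: divr_ge0 => //; apply: exprn_ge0; exact: ltW.
have H (i : 'I_n) : level_cst i.+1 * (a `^ p^-1) ^+ i.+1 *
      (level_cst (n - i) * (b `^ p^-1) ^+ (n - i)) <=
    c * (i.+1%:R ^+ 2 * (n - i)%:R ^+ 2)^-1.
  have iE : (n - i = n.+1 - i.+1)%N by rewrite subSS.
  have ki : (0 < n - i)%N by rewrite subn_gt0.
  have := @binomial_root a b n.+1 i.+1 a0 b0 (leqW (ltn_ord i)).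
  rewrite -iE -/P => bin.
  have KE : level_base ^+ n.+1 = level_base ^+ i.+1 * level_base ^+ (n - i).
    by rewrite -exprD addSn subnKC// ltnW.
  rewrite /c KE /level_cst.
  rewrite [X in X <= _](_ : _ =
    level_base ^+ i.+1 * level_base ^+ (n - i) / level_beta ^+ 2 *
    (i.+1%:R ^+ 2 * (n - i)%:R ^+ 2)^-1 *
    ((a `^ p^-1) ^+ i.+1 * (b `^ p^-1) ^+ (n - i) /
      (fact_root i.+1 * fact_root (n - i)))); last first.
    field; rewrite !pnatr_eq0 -lt0n ki !gt_eqF ?fact_root_gt0//=.
  rewrite [X in _ <= X]mulrAC; apply: ler_wpM2l => //.
  by rewrite !mulr_ge0 ?invr_ge0 ?mulr_ge0 ?exprn_ge0 ?(ltW K0) ?(ltW B0).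
apply: le_trans (ler_sum _ (fun i _ => H i)) _.
rewrite -mulr_sumr; apply: le_trans (ler_wpM2l c0 (sum_inv_sqr_conv n)) _.
rewrite /c /level_cst le_eqVlt; apply/orP; left; apply/eqP; field.
by rewrite !gt_eqF ?fact_root_gt0 ?ltr0n.
Qed.

(** The choice of [level_beta] makes the convolution bound times the sewing constant at most c / 2.
    One [level_beta] serves all levels because [sewing_const] decreases in the exponent. *)
Lemma level_sewing T (om A : R -> R -> R) n c C :
  (Num.truncn p < n.+1)%N -> 0 <= c -> control T om ->
  (forall s t u, 0 <= s -> s <= t -> t <= u -> u <= T ->
    `|A s u - A s t - A t u| <= c *
      \sum_(i < n) level_cst i.+1 * (om s t `^ p^-1) ^+ i.+1 *
        (level_cst (n - i) * (om t u `^ p^-1) ^+ (n - i))) ->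
  (forall s t, 0 <= s -> s <= t -> t <= T -> `|A s t| <= C * (t - s) ^+ 2) ->
  forall s t, 0 <= s -> s <= t -> t <= T ->
  `|A s t| <= c / 2 * (level_cst n.+1 * (om s t `^ p^-1) ^+ n.+1).
Proof.
move=> pn c0 com HA AC s t s0 st tT.
have B0 := level_beta_gt0; have b0 := level_cst_ge0 n.+1.
have rootE x : 0 <= x -> (x `^ p^-1) ^+ n.+1 = x `^ (n.+1%:R / p).
  by move=> x0; rewrite -powR_mulrn ?powR_ge0// -powRrM mulrC.
have th1 : level_theta <= n.+1%:R / p.
  by rewrite ler_pM2r ?invr_gt0// ler_nat.
pose kappa := c * (8 / level_beta * level_cst n.+1).
have kappa0 : 0 <= kappa by rewrite mulr_ge0// mulr_ge0// divr_ge0// ltW.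
have := @sewing_quadratic R T kappa (n.+1%:R / p) C om A
  (lt_le_trans level_theta_gt1 th1) kappa0 com.
move=> /(_ _ AC s t s0 st tT) H; apply: le_trans (H _) _.
  move=> s' t' u' s0' st' tu' uT'; apply: le_trans (HA _ _ _ s0' st' tu' uT') _.
  rewrite /kappa -mulrA; apply: ler_wpM2l => //.
  have tT' := le_trans tu' uT'; have t0' := le_trans s0' st'.
  apply: le_trans (level_cst_conv n (control_ge0 com s0' st' tT')
    (control_ge0 com t0' tu' uT')) _.
  apply: ler_wpM2l; first by rewrite mulr_ge0// divr_ge0// ltW.
  rewrite rootE; last by rewrite addr_ge0// (control_ge0 com).
  apply: ge0_ler_powR; rewrite ?nnegrE.
  - by rewrite divr_ge0// ltW.
  - by rewrite addr_ge0// (control_ge0 com).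
  - by rewrite (control_ge0 com)// (le_trans st').
  - exact: (control_superadd com).
rewrite rootE; last exact: (control_ge0 com).
rewrite [X in _ <= X]mulrA; apply: ler_wpM2r; first exact: powR_ge0.
set C' := sewing_const _; rewrite /kappa [X in X <= _](_ : _ =
  c / 2 * level_cst n.+1 * (16 * C' / level_beta)); last first.
  by field; rewrite gt_eqF.
apply: ler_piMr; first by rewrite mulr_ge0// divr_ge0.
rewrite ler_pdivrMr// mul1r.
have := sewing_const_le level_theta_gt1 th1.
rewrite /level_beta -/C'; lra.
Qed.

Section ExtensionEstimate.
Variables (T L eps : R) (x y : R -> R -> tseries R d) (om : R -> R -> R).
Hypothesis eps0 : 0 <= eps.
Hypothesis com : control T om.
Hypothesis xL : lipschitz_mf T L x.
Hypothesis yL : lipschitz_mf T L y.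

Hypothesis low : forall s t w, 0 <= s -> s <= t -> t <= T ->
  (0 < size w <= Num.truncn p)%N ->
  [/\ `|x s t w| <= (om s t `^ p^-1) ^+ size w,
      `|y s t w| <= (om s t `^ p^-1) ^+ size w &
      `|x s t w - y s t w| <= eps * (om s t `^ p^-1) ^+ size w].

(** The three bounds go up the levels together, since the defect of the difference involves the
    functionals themselves. [L] only serves the quadratic smallness that sewing requires and leaves
    no trace in the bounds. *)
Lemma extension_estimate s t w : 0 <= s -> s <= t -> t <= T ->
  (0 < size w)%N ->
  [/\ `|x s t w| <= level_cst (size w) * (om s t `^ p^-1) ^+ size w,
      `|y s t w| <= level_cst (size w) * (om s t `^ p^-1) ^+ size w &
      `|x s t w - y s t w| <=
        eps * (level_cst (size w) * (om s t `^ p^-1) ^+ size w)].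
Proof.
have [n] := ubnP (size w); elim: n w s t => // n IH w s t wn s0 st tT w0.
have [wp|pw] := leqP (size w) (Num.truncn p).
  have w0p : (0 < size w <= Num.truncn p)%N by rewrite w0.
  have /= [Hx Hy Hxy] := low s0 st tT w0p.
  have b1 := level_cst_ge1 w0p.
  have r0 : 0 <= (om s t `^ p^-1) ^+ size w by rewrite exprn_ge0 ?powR_ge0.
  by split; [apply: le_trans Hx _|apply: le_trans Hy _|
    apply: le_trans Hxy _; apply: ler_wpM2l => //]; rewrite ler_peMl.
have [m wm] : exists m, size w = m.+1 by exists (size w).-1; rewrite prednK.
have m0 : (0 < m)%N.
  have : (0 < Num.truncn p)%N by rewrite truncn_gt0 ltW.
  by move=> /leq_ltn_trans /(_ pw); rewrite wm ltnS.
have {}IH s' t' v : 0 <= s' -> s' <= t' -> t' <= T -> (0 < size v <= m)%N ->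
  [/\ `|x s' t' v| <= level_cst (size v) * (om s' t' `^ p^-1) ^+ size v,
      `|y s' t' v| <= level_cst (size v) * (om s' t' `^ p^-1) ^+ size v &
      `|x s' t' v - y s' t' v| <=
        eps * (level_cst (size v) * (om s' t' `^ p^-1) ^+ size v)].
  move=> ? ? ? /andP[v0 vm]; apply: IH => //; apply: leq_ltn_trans vm _.
  by rewrite -ltnS -wm.
have split_size (i : 'I_m) :
    size (take i.+1 w) = i.+1 /\ size (drop i.+1 w) = (m - i)%N.
  by rewrite size_drop size_takel wm ?subSS// leqW.
have split_le (i : 'I_m) : (0 < i.+1 <= m)%N /\ (0 < m - i <= m)%N.
  by rewrite subn_gt0 ltn_ord leq_subr.
have chen z : lipschitz_mf T L z -> forall s' t' u', 0 <= s' -> s' <= t' ->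
    t' <= u' -> u' <= T -> z s' u' w - z s' t' w - z t' u' w =
    \sum_(i < m) z s' t' (take i.+1 w) * z t' u' (drop i.+1 w).
  move=> zL s' t' u' s'0 st' tu' uT'.
  rewrite (lmf_chen zL s'0 st' tu' uT') (tprod_mid _ _ wm).
  - ring.
  - by rewrite (lmf_nil zL)// (le_trans tu').
  - by rewrite (lmf_nil zL)// (le_trans s'0).
have quad z : lipschitz_mf T L z -> forall s' t', 0 <= s' -> s' <= t' ->
    t' <= T ->
    `|z s' t' w| <= L ^+ size w * T ^+ (size w - 2) * (t' - s') ^+ 2.
  by move=> zL *; apply: (lmf_quadratic zL) => //; rewrite wm.
have half (c : R) : 0 <= c -> c / 2 <= c by move=> c0; lra.
have B0 : 0 <= level_cst m.+1 * (om s t `^ p^-1) ^+ m.+1.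
  by rewrite mulr_ge0 ?level_cst_ge0// exprn_ge0 ?powR_ge0.
have single z : lipschitz_mf T L z ->
    (forall s' t' v, 0 <= s' -> s' <= t' -> t' <= T -> (0 < size v <= m)%N ->
    `|z s' t' v| <= level_cst (size v) * (om s' t' `^ p^-1) ^+ size v) ->
    `|z s t w| <= level_cst m.+1 * (om s t `^ p^-1) ^+ m.+1.
  move=> zL zIH; have pm : (Num.truncn p < m.+1)%N by rewrite -wm.
  have := @level_sewing T om (fun s t => z s t w) m 1 _ pm ler01 com _ (quad z zL).
  move=> /(_ _ s t s0 st tT) H; apply: le_trans (H _) _; last first.
    by rewrite -[X in _ <= X]mul1r; apply: ler_wpM2r => //; exact: half.
  move=> s' t' u' s'0 st' tu' uT'; rewrite (chen z zL)// mul1r.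
  apply: le_trans (ler_norm_sum _ _ _) _; apply: ler_sum => i _.
  have [E1 E2] := split_size i; have [L1 L2] := split_le i.
  rewrite normrM; apply: ler_pM => //.
    by rewrite -{2 3}E1; apply: zIH; rewrite ?E1// (le_trans tu').
  by rewrite -E2; apply: zIH; rewrite ?E2// (le_trans s'0).
rewrite wm; split.
- apply: (single x xL) => s' t' v s'0 st' tT' vm.
  by have [] := IH s' t' v s'0 st' tT' vm.
- apply: (single y yL) => s' t' v s'0 st' tT' vm.
  by have [] := IH s' t' v s'0 st' tT' vm.
have pm : (Num.truncn p < m.+1)%N by rewrite -wm.
(* The difference a1 a2 - b1 b2 splits into two products, each carrying one factor [eps]; the factor
   1/2 in [level_sewing] compensates for the 2. *)
have eps20 : 0 <= eps * 2 by rewrite mulr_ge0.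
have := @level_sewing T om (fun s t => x s t w - y s t w) m (eps * 2)
  (L ^+ size w * T ^+ (size w - 2) + L ^+ size w * T ^+ (size w - 2)) pm eps20 com.
rewrite mulfK ?pnatr_eq0// => /(_ _ _ s t s0 st tT); apply; last first.
  move=> s' t' s'0 st' tT'; rewrite mulrDl; apply: le_trans (ler_normB _ _) _.
  by apply: lerD; apply: quad.
move=> s' t' u' s'0 st' tu' uT'.
have -> : x s' u' w - y s' u' w - (x s' t' w - y s' t' w) -
  (x t' u' w - y t' u' w) = (x s' u' w - x s' t' w - x t' u' w) -
  (y s' u' w - y s' t' w - y t' u' w) by ring.
rewrite (chen x xL)// (chen y yL)// -sumrB mulr_sumr.
apply: le_trans (ler_norm_sum _ _ _) _; apply: ler_sum => i _.
have [E1 E2] := split_size i; have [L1 L2] := split_le i.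
have t0' := le_trans s'0 st'; have tT' := le_trans tu' uT'.
have [|X1 Y1 D1] := IH s' t' (take i.+1 w) s'0 st' tT'; first by rewrite E1.
have [|X2 Y2 D2] := IH t' u' (drop i.+1 w) t0' tu' uT'; first by rewrite E2.
rewrite E1 in X1 Y1 D1; rewrite E2 in X2 Y2 D2.
set a1 := x s' t' _ in X1 D1 *; set b1 := y s' t' _ in Y1 D1 *.
set a2 := x t' u' _ in X2 D2 *; set b2 := y t' u' _ in Y2 D2 *.
have -> : a1 * a2 - b1 * b2 = (a1 - b1) * a2 + b1 * (a2 - b2) by ring.
apply: le_trans (ler_normD _ _) _; rewrite !normrM mulr_natr mulr2n mulrDl.
apply: lerD.
  by rewrite [X in _ <= X]mulrA; apply: ler_pM.
by rewrite [X in _ <= X]mulrCA; apply: ler_pM.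
Qed.

End ExtensionEstimate.

End LevelBounds.

(** * Iterated integrals of dyadic interpolations *)

Lemma Rintegral_sum (disp : measure_display) (U : measurableType disp)
    (R : realType) (mu : {measure set U -> \bar R}) (D : set U) n
    (f : 'I_n -> U -> R) : measurable D ->
  (forall i, mu.-integrable D (EFin \o f i)) ->
  \int[mu]_(x in D) (\sum_(i < n) f i x) =
  \sum_(i < n) \int[mu]_(x in D) f i x.
Proof.
move=> mD fi; rewrite /Rintegral sum_fine => [|i _]; last first.
  exact: (integrable_fin_num mD (fi i)).
rewrite -(integral_sum mD fi); congr fine.
by apply: eq_integral => x _ /=; rewrite sumEFin.
Qed.

Section IteratedIntegrals.
Context {R : realType} {d : nat}.
Implicit Types (s t u T L : R) (w : seq 'I_d) (f : R -> R).
Notation mu := (@lebesgue_measure R).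

Lemma bounded_itv_integrable s t M f : measurable_fun `[s, t] f ->
  (forall u, s <= u -> u <= t -> `|f u| <= M) ->
  mu.-integrable `[s, t] (EFin \o f).
Proof.
move=> mf fM; apply: measurable_bounded_integrable => //.
- rewrite /= lebesgue_measure_itv/=.
  by case: ifP => // _; rewrite -EFinD ltry.
- exists M; split; first exact: num_real.
  move=> B MB u /=; rewrite in_itv/= => /andP[su ut].
  exact: le_trans (fM u su ut) (ltW MB).
Qed.

Lemma Rintegral_itv_chasles s t u f : s <= t -> t <= u ->
  mu.-integrable `[s, u] (EFin \o f) ->
  \int[mu]_(x in `[s, u]) f x =
  \int[mu]_(x in `[s, t]) f x + \int[mu]_(x in `[t, u]) f x.
Proof.
move=> st tu fi; apply/eqP; rewrite addrC -subr_eq; apply/eqP.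
rewrite (Rintegral_itvB fi) ?bnd_simp// Rintegral_itv_obnd_cbnd//.
by apply: integrableS fi => //; apply: subset_itvr; rewrite bnd_simp.
Qed.

Lemma le_Rintegral_itv s t M f : s <= t -> measurable_fun `[s, t] f ->
  (forall u, s <= u -> u <= t -> `|f u| <= M) ->
  `|\int[mu]_(u in `[s, t]) f u| <= M * (t - s).
Proof.
move=> st mf fM; have fi := bounded_itv_integrable mf fM.
apply: le_trans (le_normr_Rintegral _ fi) _ => //.
have -> : M * (t - s) = \int[mu]_(u in `[s, t]) M.
  rewrite Rintegral_cst//; congr (_ * _).
  move: st; rewrite /= lebesgue_measure_itv/= lte_fin le_eqVlt.
  by case/orP => [/eqP ->|->//]; rewrite ltxx subrr.
apply: le_Rintegral => //.
- exact: integrable_norm fi.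
- by apply: (@bounded_itv_integrable _ _ `|M|).
- by move=> u /=; rewrite in_itv/= => /andP[su ut]; exact: fM.
Qed.

Section BoundedDerivative.
Variables (T L : R) (x : R -> 'rV[R]_d).
Hypothesis L0 : 0 <= L.
Let g (i : 'I_d) : R -> R := derive1 (fun v => x v 0 i).
Hypothesis mg : forall i, measurable_fun `[0, T] (g i).
Hypothesis gL : forall i u, 0 <= u -> u <= T -> `|g i u| <= L.

Let integrand i t w u := g i u * iter_int x u t w.

(** Both properties are proved in one induction on the word, as together they make the next
    integrand integrable. *)
Let iter_int_prop t w := measurable_fun `[0, t] (fun u => iter_int x u t w) /\
  forall u, 0 <= u -> u <= t -> `|iter_int x u t w| <= (L * (t - u)) ^+ size w.

Let integrand_meas i t w : 0 <= t -> t <= T -> iter_int_prop t w ->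
  measurable_fun `[0, t] (integrand i t w).
Proof.
move=> t0 tT [mI _]; apply: measurable_funM => //.
apply: measurable_funS (mg i) => //.
by apply: subset_itvl; rewrite bnd_simp.
Qed.

Let integrand_le i t w s u : 0 <= s -> s <= u -> u <= t -> t <= T ->
  iter_int_prop t w ->
  `|integrand i t w u| <= L * (L * (t - s)) ^+ size w.
Proof.
move=> s0 su ut tT [_ IL]; have u0 := le_trans s0 su.
rewrite normrM; apply: ler_pM => //; first exact: gL (le_trans ut tT).
apply: le_trans (IL u u0 ut) _.
by rewrite lerXn2r ?nnegrE ?mulr_ge0 ?ler_wpM2l//; lra.
Qed.

Let subitv_meas s t (h : R -> R) : 0 <= s -> measurable_fun `[0, t] h ->
  measurable_fun `[s, t] h.
Proof.
move=> s0; apply: measurable_funS => //.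
by apply: subset_itvr; rewrite bnd_simp.
Qed.

Let iter_intP t w : 0 <= t -> t <= T -> iter_int_prop t w.
Proof.
move=> t0 tT; elim: w => [|i w IH].
  by split=> [|u _ _] /=; [exact: measurable_cst|rewrite normr1 expr0].
have mI := integrand_meas i t0 tT IH.
have intI : mu.-integrable `[0, t] (EFin \o integrand i t w).
  apply: (@bounded_itv_integrable _ _ (L * (L * (t - 0)) ^+ size w)) => //.
  by move=> u u0 ut; exact: integrand_le.
split=> [|u u0 ut] /=; last first.
  rewrite exprS mulrAC.
  apply: (@le_Rintegral_itv _ _ _ (integrand i t w)) => //.
  - exact: subitv_meas.
  - by move=> r ur rt; exact: integrand_le.
(* As a function of its lower endpoint the integral is a constant minus an integral from 0 to [u],
   which is continuous in [u], hence measurable. *)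
have E u : u \in [set` `[0, t]] ->
    \int[mu]_(r in `[0, t]) integrand i t w r -
    parameterized_integral mu 0 u (integrand i t w) =
    iter_int x u t (i :: w).
  rewrite inE /= in_itv/= => /andP[u0 ut].
  by rewrite (Rintegral_itv_chasles u0 ut intI) addrAC subrr add0r.
apply: eq_measurable_fun E _; apply: measurable_funB; first exact: measurable_cst.
apply: subspace_continuous_measurable_fun => //.
exact: parameterized_integral_continuous.
Qed.

(** Chen's identity goes by induction on the word, splitting the range of the outermost variable at
    [t]. Beyond [t] all variables lie in [t, u]; before [t] the induction hypothesis applies to the
    inner integral. *)
Lemma iter_int_lipschitz : lipschitz_mf T L (iter_int x).
Proof.
split=> //.
- move=> s t u s0 st tu uT; apply/funext => w.
  have t0 := le_trans s0 st; have tT := le_trans tu uT.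
  have u0 := le_trans t0 tu.
  elim: w s s0 st => [|i w IH] s s0 st.
    by rewrite /tprod big_ord1/= mulr1.
  rewrite tprod_cons//=.
  have intI v r : 0 <= r -> r <= T ->
      mu.-integrable `[s, r] (EFin \o integrand i r v).
    move=> r0 rT; have P := iter_intP v r0 rT.
    apply: (@bounded_itv_integrable _ _ (L * (L * (r - s)) ^+ size v)).
      by apply: subitv_meas => //; exact: integrand_meas.
    by move=> r' *; exact: integrand_le.
  rewrite -[LHS]/(\int[mu]_(r in `[s, u]) integrand i u w r).
  rewrite (Rintegral_itv_chasles st tu (intI w u u0 uT)) addrC; congr (_ + _).
  rewrite (@eq_Rintegral _ _ _ mu _ (fun r => \sum_(k < (size w).+1)
     integrand i t (take k w) r * iter_int x t u (drop k w))); last first.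
    move=> r; rewrite inE/= in_itv/= => /andP[sr rt].
    rewrite /integrand IH ?(le_trans s0)// /tprod mulr_sumr.
    by apply: eq_bigr => k _; rewrite mulrA.
  have intk (k : 'I_(size w).+1) : mu.-integrable `[s, t]
      (EFin \o (fun r => integrand i t (take k w) r * iter_int x t u (drop k w))).
    apply: (@bounded_itv_integrable _ _ (L * (L * (t - s)) ^+ size (take k w) *
      `|iter_int x t u (drop k w)|)).
      apply: measurable_funM; last exact: measurable_cst.
      by apply: subitv_meas => //; apply: integrand_meas => //; exact: iter_intP.
    move=> r sr rt; rewrite normrM ler_wpM2r//; apply: integrand_le => //.
    exact: iter_intP.
  rewrite Rintegral_sum//; apply: eq_bigr => k _.
  by rewrite RintegralZr//; exact: intI.
- move=> s t w s0 st tT; have t0 := le_trans s0 st.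
  by have [_] := iter_intP w t0 tT; apply.
Qed.

End BoundedDerivative.
End IteratedIntegrals.

(** * Piecewise affine paths have a bounded measurable derivative *)

Section DyadicInterpolation.
Context {R : realType} {d : nat}.
Variables (T : R) (m : nat) (x : R -> 'rV[R]_d).
Hypothesis T0 : 0 < T.

Let h := T / 2 ^+ m.
Let h0 : 0 < h. Proof. by rewrite divr_gt0 ?exprn_gt0. Qed.
Let G i : R -> R := derive1 (fun v => dyadic_interp T m x v 0 i).

Lemma derive1_affine (a k u : R) : derive1 (fun v => a + k * v) u = k.
Proof.
rewrite derive1E; have -> : (fun v => a + k * v) = cst a + k *: (id : R -> R).
  by apply/funext.
by rewrite derive_val add0r /GRing.scale/= mulr1.
Qed.

Let dyadic_interp_slope i l u : l%:R * h < u -> u < l.+1%:R * h ->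
  G i u = (x (l.+1%:R * h) - x (l%:R * h)) 0 i / h.
Proof.
move=> lu ul; rewrite /G; set D := (x _ - x _) 0 i.
rewrite -[RHS](derive1_affine (x (l%:R * h) 0 i - l%:R * D) _ u) !derive1E.
apply: near_eq_derive; near=> v.
have lv : l%:R * h < v by near: v; exact: lt_nbhsr.
have vl : v < l.+1%:R * h by near: v; exact: lt_nbhsl.
rewrite /dyadic_interp -/h (@truncn_def _ _ l); last first.
  by rewrite ler_pdivlMr// ltr_pdivrMr// (ltW lv).
by rewrite !mxE -/D /D !mxE; ring.
Unshelve. all: by end_near. Qed.

(** One cell is added at a time. At the dyadic points [derive1] has some unspecified value, which is
    simply included in the bound. *)
Let dyadic_interp_derive i n : exists B, measurable_fun `[0, n%:R * h] (G i) /\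
  forall u, 0 <= u -> u <= n%:R * h -> `|G i u| <= B.
Proof.
elim: n => [|n [B [mG GB]]].
  exists `|G i 0|; rewrite mul0r set_itv1; split; first exact: measurable_fun_set1.
  by move=> u u0 uz; rewrite (@le_anti _ _ u 0)// uz u0.
have nh0 : 0 <= n%:R * h by rewrite mulr_ge0// ltW.
have nh1 : n%:R * h < n.+1%:R * h by rewrite ltr_pM2r// ltr_nat.
set k := (x (n.+1%:R * h) - x (n%:R * h)) 0 i / h.
exists (B + `|k| + `|G i (n.+1%:R * h)|); split; last first.
  move=> u u0; have := GB u u0; have B0 := le_trans (normr_ge0 _) (GB 0 (lexx _) nh0).
  have [un|nu] := leP u (n%:R * h).
    by move=> /(_ isT) GuB _; rewrite -addrA; apply: le_trans GuB _; rewrite lerDl addr_ge0.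
  move=> _; rewrite le_eqVlt => /orP[/eqP ->|un1].
    by rewrite lerDr addr_ge0.
  by rewrite (dyadic_interp_slope i nu un1) -/k addrAC lerDr addr_ge0.
have -> : `[0, n.+1%:R * h]%classic = `[0, n%:R * h]%classic `|`
    (`]n%:R * h, n.+1%:R * h[%classic `|` [set n.+1%:R * h]).
  apply/seteqP; split=> u /=; rewrite !in_itv/=.
    move=> /andP[u0]; rewrite le_eqVlt => /orP[/eqP ->|un1]; first by right; right.
    by have [un|nu] := leP u (n%:R * h); [left; rewrite u0|right; left; rewrite un1].
  move=> [/andP[-> un]|[/andP[nu un1]|->]] /=.
  - by rewrite (le_trans un)// ltW.
  - by rewrite (ltW un1) (le_trans nh0)// ltW.
  - by rewrite lexx (le_trans nh0)// ltW.
apply/measurable_funU => //; first exact: measurableU.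
split=> //; apply/measurable_funU => //; split; last exact: measurable_fun_set1.
apply: (@eq_measurable_fun _ _ _ _ _ (cst k)); last exact: measurable_cst.
move=> u; rewrite inE/= in_itv/= => /andP[nu un1].
by rewrite (dyadic_interp_slope i nu un1).
Qed.

Lemma dyadic_interp_lipschitz :
  exists L, lipschitz_mf T L (iter_int (dyadic_interp T m x)).
Proof.
have Th : (2 ^ m)%:R * h = T by rewrite natrX mulrC divfK// expf_neq0.
have /fin_all_exists [B HB] i := dyadic_interp_derive i (2 ^ m).
rewrite Th in HB.
have B0 i : 0 <= B i.
  by have [_ /(_ 0 (lexx _) (ltW T0))] := HB i; apply: le_trans.
exists (\sum_i B i); apply: iter_int_lipschitz.
- exact: sumr_ge0.
- by move=> i; case: (HB i).
- move=> i u u0 uT; have [_ /(_ u u0 uT) H] := HB i; apply: le_trans H _.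
  by rewrite (bigD1 i)//= lerDl sumr_ge0.
Qed.

End DyadicInterpolation.

(** * Variation distances *)

Section PartitionNorms.
Context {R : realType} {d : nat}.
Implicit Types (X Y : R -> R -> tseries R d) (p T q : R).

Lemma cvgn_cauchy (u : nat -> R) :
  (forall e, 0 < e -> exists n, forall i j, (n <= i)%N -> (n <= j)%N ->
    `|u i - u j| <= e) -> cvgn u.
Proof.
move=> H; apply/cauchy_cvgP/cauchy_exP => e e0.
have [|n Hn] := H (e / 2); first by rewrite divr_gt0.
exists (u n), n => // j /= nj; apply: le_lt_trans (Hn _ _ (leqnn n) nj) _; lra.
Qed.

Lemma cvgn_sum (I : Type) (r : seq I) (P : pred I) (u : I -> nat -> R) (l : I -> R) :
  (forall i, u i n @[n --> \oo] --> l i) ->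
  \sum_(i <- r | P i) u i n @[n --> \oo] --> \sum_(i <- r | P i) l i.
Proof.
move=> ul; elim: r => [|i r IH].
  by under eq_fun do rewrite big_nil; rewrite big_nil; exact: cvg_cst.
under eq_fun do rewrite big_cons; rewrite big_cons.
by case: ifP => // _; apply: cvgD.
Qed.

(** The limit 0 is treated by hand, since the power is differentiable only at positive points. *)
Lemma cvgn_powR (u : nat -> R) (l q : R) : 0 < q -> (forall n, 0 <= u n) ->
  u n @[n --> \oo] --> l -> u n `^ q @[n --> \oo] --> l `^ q.
Proof.
move=> q0 u0 ul; have l0 : 0 <= l.
  by apply: (@ler_cvg_to _ \oo _ _ (fun=> 0) u) => //; [exact: cvg_cst|exact: nearW].
move: l0; rewrite le_eqVlt => /orP[/eqP lE|l0].
  rewrite -lE powR0 ?gt_eqF//; apply/cvgrPdist_le => e e0.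
  have e0' : 0 < e `^ q^-1 by rewrite powR_gt0.
  move/cvgrPdist_le : ul => /(_ _ e0'); apply: filterS => n.
  rewrite -lE !sub0r !normrN !ger0_norm ?powR_ge0// => ue.
  have -> : e = (e `^ q^-1) `^ q.
    by rewrite -powRrM mulVf ?gt_eqF// powRr1// ltW.
  by apply: ge0_ler_powR; rewrite ?nnegrE ?powR_ge0// ltW.
apply: (cvg_comp u (fun x => x `^ q) ul).
have dq : derivable (fun x : R => x `^ q) l 1.
  by apply: derivable_powR; rewrite in_itv/= l0.
exact: differentiable_continuous ((derivable1_diffP _ _).1 dq).
Qed.

Lemma level_norm_ge0 k (x : tseries R d) : 0 <= level_norm k x.
Proof. exact: sqrtr_ge0. Qed.

Lemma le_level_norm (x : tseries R d) w : `|x w| <= level_norm (size w) x.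
Proof.
rewrite -sqrtr_sqr /level_norm (bigD1 (in_tuple w))//=.
by apply: ler_wsqrtr; rewrite lerDl sumr_ge0// => v _; exact: sqr_ge0.
Qed.

(** There are d^k words, and the square root of d^k is bounded by d^k. The loss is geometric in k,
    and the factorial decay outweighs it. *)
Lemma level_norm_le k (x : tseries R d) (b : R) : 0 <= b ->
  (forall w, size w = k -> `|x w| <= b) -> level_norm k x <= d%:R ^+ k * b.
Proof.
move=> b0 H; have D0 : 0 <= d%:R ^+ k :> R by rewrite exprn_ge0.
rewrite -[leRHS]ger0_norm ?mulr_ge0// -sqrtr_sqr ler_wsqrtr//.
apply: (@le_trans _ _ (\sum_(w : k.-tuple 'I_d) b ^+ 2)).
  apply: ler_sum => w _; rewrite -[leLHS]real_normK ?num_real//.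
  by rewrite lerXn2r ?nnegrE// H// size_tuple.
rewrite sumr_const card_tuple card_ord exprMn -[leLHS]mulr_natl.
apply: ler_wpM2r; first exact: sqr_ge0.
by rewrite -!natrX ler_nat -mulnn; case: (d ^ k)%N => // n; exact: leq_pmull.
Qed.

Lemma cvgn_level_norm k (x : nat -> tseries R d) (y : tseries R d) :
  (forall w, x n w @[n --> \oo] --> y w) ->
  level_norm k (x n) @[n --> \oo] --> level_norm k y.
Proof.
move=> xy; rewrite /level_norm.
apply: (cvg_comp (fun n => \sum_(w : k.-tuple 'I_d) x n w ^+ 2)); last first.
  exact: sqrt_continuous.
apply: cvgn_sum => w; under eq_fun do rewrite expr2.
by rewrite expr2; apply: cvgM.
Qed.

Lemma cvgn_vsum (f : nat -> R -> R -> R) (g : R -> R -> R) s T D : 0 <= s ->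
  path <=%O s D -> last s D <= T ->
  (forall u v, 0 <= u -> u <= v -> v <= T -> f n u v @[n --> \oo] --> g u v) ->
  vsum (f n) s D @[n --> \oo] --> vsum g s D.
Proof.
move=> + + + fg; elim: D s => [|t D IH] s s0 /=; first by move=> *; exact: cvg_cst.
move=> /andP[st tD] DT; apply: cvgD.
  by apply: fg => //; exact: le_trans (path_le_last tD) DT.
by apply: IH => //; exact: le_trans st.
Qed.

Lemma pvar_dist_le p T k X Y C :
  (forall D, itv_partition 0 T D ->
    vsum (fun u v => level_norm k (fun w => X u v w - Y u v w) `^ (p / k%:R)) 0 D
    <= C) -> 0 < p ->
  (pvar_dist p T k X Y <= (C `^ (k%:R / p))%:E)%E.
Proof.
move=> H p0; apply: ge_ereal_sup => _ [D DT <-]; rewrite lee_fin.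
have := H D DT; rewrite -(vsum_nth _ T) => HD.
have S0 : 0 <= \sum_(0 <= i < size D) level_norm k (fun w =>
    X (nth T (0 :: D) i) (nth T (0 :: D) i.+1) w -
    Y (nth T (0 :: D) i) (nth T (0 :: D) i.+1) w) `^ (p / k%:R).
  by apply: sumr_ge0 => i _; exact: powR_ge0.
apply: ge0_ler_powR; rewrite ?nnegrE//; first by rewrite divr_ge0// ltW.
exact: le_trans S0 HD.
Qed.

Lemma pvar_dist_ge p T k X Y e D : 0 < p -> (0 < k)%N ->
  (pvar_dist p T k X Y <= e%:E)%E -> itv_partition 0 T D ->
  vsum (fun u v => level_norm k (fun w => X u v w - Y u v w) `^ (p / k%:R)) 0 D
  <= e `^ (p / k%:R).
Proof.
move=> p0 k0 H DT; set S := vsum _ _ _.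
have S0 : 0 <= S by apply: vsum_ge0 => u v; exact: powR_ge0.
have : S `^ (k%:R / p) <= e.
  rewrite -lee_fin; apply: le_trans H; apply: ereal_sup_ubound.
  by exists D => //; rewrite /S -(vsum_nth _ T).
have k0' : 0 < k%:R :> R by rewrite ltr0n.
move=> Se; have SE : S = (S `^ (k%:R / p)) `^ (p / k%:R).
  rewrite -powRrM (_ : k%:R / p * (p / k%:R) = 1) ?powRr1//.
  by field; rewrite !gt_eqF.
rewrite SE; apply: ge0_ler_powR; rewrite ?nnegrE ?powR_ge0//.
  by rewrite divr_ge0// ltW.
exact: le_trans (powR_ge0 _ _) Se.
Qed.

Lemma pvar_dist_ge0 p T k X Y : 0 < T -> (0 <= pvar_dist p T k X Y)%E.
Proof.
move=> T0; apply: le_ereal_sup_tmp; eexists.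
  by exists [:: T]; first exact: itv_partition1.
by rewrite lee_fin powR_ge0.
Qed.

Lemma rp_dist_ge0 p T n X Y : (0 <= rp_dist p T n X Y)%E.
Proof.
by rewrite /rp_dist; elim/big_rec : _ => // i y _ y0; rewrite le_max y0 orbT.
Qed.

Lemma le_bigmaxe (r : seq nat) (F : nat -> \bar R) k : k \in r ->
  (F k <= \big[maxe/0%E]_(i <- r) F i)%E.
Proof.
elim: r => // i r IH; rewrite in_cons big_cons le_max.
by case/orP=> [/eqP <-|/IH ->]; rewrite ?lexx ?orbT.
Qed.

Lemma bigmaxe_le (r : seq nat) (F : nat -> \bar R) (e : \bar R) : (0 <= e)%E ->
  (forall k, k \in r -> (F k <= e)%E) -> (\big[maxe/0%E]_(i <- r) F i <= e)%E.
Proof.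
move=> e0; elim: r => [|i r IH] H; first by rewrite big_nil.
rewrite big_cons ge_max H ?mem_head// IH// => k kr.
by rewrite H// in_cons kr orbT.
Qed.

Lemma pvar_dist_le_rp_dist p T n k X Y : (0 < k <= n)%N ->
  (pvar_dist p T k X Y <= rp_dist p T n X Y)%E.
Proof.
move=> kn; apply: (le_bigmaxe (fun k => pvar_dist p T k X Y)).
by rewrite mem_index_iota.
Qed.

Lemma rp_dist_le p T n X Y (e : \bar R) : (0 <= e)%E ->
  (forall k, (0 < k <= n)%N -> (pvar_dist p T k X Y <= e)%E) ->
  (rp_dist p T n X Y <= e)%E.
Proof.
move=> e0 H; apply: bigmaxe_le => // k; rewrite mem_index_iota => kn.
exact: (H k kn).
Qed.

Lemma cvge0_le (f : nat -> \bar R) : (forall i, 0 <= f i)%E ->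
  (f @ \oo --> 0%E <->
   forall e : R, 0 < e -> \forall i \near \oo, (f i <= e%:E)%E).
Proof.
move=> f0; split=> [/fine_cvgP[ff /cvgrPdist_le fc] e e0|H].
  move: (fc e e0); apply: filterS2 ff => i fi.
  by rewrite /= sub0r normrN ger0_norm ?fine_ge0// -lee_fin fineK.
apply/fine_cvgP; split.
  apply: filterS (H 1 ltr01) => i fi; rewrite ge0_fin_numE//.
  exact: le_lt_trans fi (ltry _).
apply/cvgrPdist_le => e e0; apply: filterS (H e e0) => i fi.
rewrite /= sub0r normrN ger0_norm ?fine_ge0// -lee_fin fineK//.
by rewrite ge0_fin_numE// (le_lt_trans fi)// ltry.
Qed.

End PartitionNorms.

(** * Uniform bounds and the limiting signature *)

Section UniformEstimate.
Context {R : realType} {d : nat}.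
Variables (T p : R) (X : nat -> R -> R -> tseries R d) (Z : R -> R -> tseries R d).
Variable (L : nat -> R).
Hypothesis T0 : 0 < T.
Hypothesis p1 : 1 < p.
Hypothesis XL : forall m, lipschitz_mf T (L m) (X m).
Hypothesis XZ : rp_dist p T (Num.truncn p) (X m) Z @[m --> \oo] --> 0%E.
Implicit Types (s t u v : R) (w : seq 'I_d) (D : seq R).

Let p0 : 0 < p. Proof. exact: lt_trans p1. Qed.

Let low w := (0 < size w <= Num.truncn p)%N.
Let ex w : R := p / (size w)%:R.

Let low_gt0 w : low w -> 0 < (size w)%:R :> R.
Proof. by rewrite ltr0n => /andP[]. Qed.

Let exE w : low w -> (size w)%:R * ex w = p.
Proof. by move=> /low_gt0 w0; rewrite mulrC divfK// gt_eqF. Qed.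

Let ex_gt0 w : low w -> 0 < ex w.
Proof. by move=> /low_gt0 w0; rewrite divr_gt0. Qed.

Let ex_le w : low w -> ex w <= p.
Proof.
move=> lw; rewrite ler_pdivrMr ?low_gt0// ler_peMr ?(ltW p0)//.
by rewrite ler1n; case/andP: lw.
Qed.

(** Since a is at most twice the maximum of b and c, exponents below and above 1 are treated alike;
    [r] allows one constant for all levels. *)
Lemma powR_le_double (a b c q r : R) : 0 <= a -> 0 <= b -> 0 <= c ->
  a <= b + c -> 0 <= q -> q <= r -> a `^ q <= 2 `^ r * (b `^ q + c `^ q).
Proof.
move=> a0 b0 c0 abc q0 qr.
have H x : 0 <= x -> a <= 2 * x -> a `^ q <= 2 `^ r * x `^ q.
  move=> x0 ax; apply: (@le_trans _ _ ((2 * x) `^ q)).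
    by apply: ge0_ler_powR; rewrite ?nnegrE// mulr_ge0.
  rewrite powRM//; apply: ler_wpM2r; first exact: powR_ge0.
  by apply: ler_powR => //; rewrite ler1n.
have [bc|/ltW cb] := leP b c.
  apply: le_trans (H c c0 _) _; first lra.
  by rewrite ler_wpM2l ?powR_ge0// lerDr powR_ge0.
apply: le_trans (H b b0 _) _; first lra.
by rewrite ler_wpM2l ?powR_ge0// lerDl powR_ge0.
Qed.

Lemma vsum_le_itv (phi phi' : R -> R -> R) D : itv_partition 0 T D ->
  (forall u v, 0 <= u -> u <= v -> v <= T -> phi u v <= phi' u v) ->
  vsum phi 0 D <= vsum phi' 0 D.
Proof.
move=> [DT /eqP lD] H; apply: (@vsum_le _ _ _ _ T) => //; last by rewrite lD.
exact: path_ltW.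
Qed.

Let vsum_word_dist w m e D : low w ->
  (rp_dist p T (Num.truncn p) (X m) Z <= e%:E)%E -> itv_partition 0 T D ->
  vsum (fun u v => `|X m u v w - Z u v w| `^ ex w) 0 D <= e `^ ex w.
Proof.
move=> lw XZe DT; have /andP[w0 _] := lw.
have := pvar_dist_ge p0 w0 (le_trans (pvar_dist_le_rp_dist _ _ _ _ lw) XZe) DT.
apply: le_trans; apply: vsum_le_itv => // u v _ _ _.
apply: ge0_ler_powR; rewrite ?nnegrE ?level_norm_ge0 ?(ltW (ex_gt0 lw))//.
exact: (le_level_norm (fun w => X m u v w - Z u v w)).
Qed.

(** At the exponent p / |w| every level gives (L (v - u))^p, and p > 1 allows all but one power of v
    - u to be bounded by a power of T. *)
Let vsum_word_lipschitz w m D : low w -> itv_partition 0 T D ->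
  vsum (fun u v => `|X m u v w| `^ ex w) 0 D <= (L m) `^ p * T `^ p.
Proof.
move=> lw DT; have L0 := lmf_ge0 (XL m).
have -> : L m `^ p * T `^ p =
    vsum (fun u v => (L m `^ p * T `^ (p - 1)) * (v - u)) 0 D.
  rewrite vsumZ vsum_sub subr0; case: DT => _ /eqP ->.
  by rewrite -mulrA [_ * T]mulrC mulr_powRB1// ltW.
apply: vsum_le_itv => // u v u0 uv vT.
have vu0 : 0 <= v - u by rewrite subr_ge0.
apply: (@le_trans _ _ ((L m * (v - u)) `^ p)).
  have -> : (L m * (v - u)) `^ p = ((L m * (v - u)) ^+ size w) `^ ex w.
    by rewrite -powR_mulrn ?mulr_ge0// -powRrM exE.
  apply: ge0_ler_powR; rewrite ?nnegrE ?(ltW (ex_gt0 lw)) ?exprn_ge0 ?mulr_ge0//.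
  exact: (lmf_le (XL m)).
rewrite powRM// -mulrA; apply: ler_wpM2l; first exact: powR_ge0.
rewrite -(mulr_powRB1 vu0 p0) mulrC; apply: ler_wpM2r => //.
apply: ge0_ler_powR; rewrite ?nnegrE ?subr_ge0 ?(ltW p1) ?(ltW T0)//.
by apply: le_trans vT; rewrite gerBl.
Qed.

(** [M] is chosen before [eps]: for late indices the difference divided by [eps] has a variation
    bounded by a universal constant, so the mass of the control does not grow as [eps] shrinks. *)
Lemma uniform_extension_estimate : exists M, [/\ 0 <= M &
  forall eps, 0 < eps -> exists n, forall i j, (n <= i)%N -> (n <= j)%N ->
  exists om, [/\ control T om, om 0 T <= M &
  forall s t w, 0 <= s -> s <= t -> t <= T -> (0 < size w)%N ->
  `|X i s t w| <= level_cst p (size w) * (om s t `^ p^-1) ^+ size w /\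
  `|X i s t w - X j s t w| <=
    eps * (level_cst p (size w) * (om s t `^ p^-1) ^+ size w)]].
Proof.
have XZe e : 0 < e -> exists n, forall i, (n <= i)%N ->
    (rp_dist p T (Num.truncn p) (X i) Z <= e%:E)%E.
  move=> e0; move/cvge0_le : XZ => /(_ (fun i => rp_dist_ge0 _ _ _ _ _) e e0).
  by move=> [n _ Hn]; exists n => i ni; exact: Hn.
(* The one interpolation whose Lipschitz constant enters [M]: it bounds the variation of [Z], and
   [Z] in turn bounds that of all later interpolations. *)
have [n1 Hn1] := XZe 1 ltr01.
pose A := L n1 `^ p * T `^ p.
have A0 : 0 <= A by rewrite mulr_ge0 ?powR_ge0.
pose c2 : R := 2 `^ p; have c20 : 0 <= c2 := powR_ge0 _ _.
pose M1 := c2 * (1 + A).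
pose M2 := c2 * (1 + M1).
(* Two functionals, and their difference over [eps], estimated through [Z]. *)
pose M3 := M2 + M2 + c2 * (1 + 1).
pose M := \sum_(k < Num.truncn p) \sum_(w : k.+1.-tuple 'I_d) M3.
have M10 : 0 <= M1 by rewrite mulr_ge0// addr_ge0.
have M20 : 0 <= M2 by rewrite mulr_ge0// addr_ge0.
have M30 : 0 <= M3 by rewrite !addr_ge0// mulr_ge0.
exists M; split=> [|eps eps0].
  by apply: sumr_ge0 => k _; apply: sumr_ge0.
(* Distance 1 bounds the variation of [X i] by that of [Z]; distance [eps] bounds the quotient by
   [eps]. *)
pose e := Num.min 1 eps.
have e0 : 0 < e by rewrite lt_min ltr01.
have [n Hn] := XZe e e0.
have dist1 w i D : low w -> itv_partition 0 T D ->
    (rp_dist p T (Num.truncn p) (X i) Z <= 1%:E)%E ->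
    vsum (fun u v => `|X i u v w - Z u v w| `^ ex w) 0 D <= 1.
  move=> lw DT XZ1; apply: le_trans (vsum_word_dist lw XZ1 DT) _.
  by rewrite powR1.
have disteps w i D : low w -> itv_partition 0 T D -> (n <= i)%N ->
    vsum (fun u v => (`|X i u v w - Z u v w| / eps) `^ ex w) 0 D <= 1.
  move=> lw DT ni.
  apply: (@le_trans _ _ (vsum (fun u v =>
     eps^-1 `^ ex w * `|X i u v w - Z u v w| `^ ex w) 0 D)).
    apply: vsum_le_itv => // u v _ _ _.
    by rewrite mulrC powRM// invr_ge0 ltW.
  rewrite vsumZ; apply: (@le_trans _ _ (eps^-1 `^ ex w * e `^ ex w)).
    by apply: ler_wpM2l; [exact: powR_ge0|exact: vsum_word_dist (Hn _ ni) _].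
  rewrite -powRM ?invr_ge0 ?(ltW eps0) ?(ltW e0)//.
  apply: (@le_trans _ _ (1 `^ ex w)); last by rewrite powR1.
  apply: ge0_ler_powR;
    rewrite ?nnegrE ?(ltW (ex_gt0 lw)) ?mulr_ge0 ?invr_ge0 ?(ltW eps0) ?(ltW e0)//.
  by rewrite mulrC ler_pdivrMr// mul1r ge_min lexx orbT.
have Zbnd w D : low w -> itv_partition 0 T D ->
    vsum (fun u v => `|Z u v w| `^ ex w) 0 D <= M1.
  move=> lw DT; apply: (@le_trans _ _ (vsum (fun u v => c2 *
    (`|X n1 u v w - Z u v w| `^ ex w + `|X n1 u v w| `^ ex w)) 0 D)).
    apply: vsum_le_itv => // u v _ _ _; apply: powR_le_double => //.
    - by rewrite distrC; apply: le_trans (ler_normD _ _); rewrite subrK.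
    - exact: ltW (ex_gt0 lw).
    - exact: ex_le.
  rewrite vsumZ vsumD ler_wpM2l// lerD//.
    by apply: dist1 => //; exact: Hn1.
  exact: vsum_word_lipschitz.
have Xbnd w i D : low w -> itv_partition 0 T D -> (n <= i)%N ->
    vsum (fun u v => `|X i u v w| `^ ex w) 0 D <= M2.
  move=> lw DT ni; apply: (@le_trans _ _ (vsum (fun u v => c2 *
    (`|X i u v w - Z u v w| `^ ex w + `|Z u v w| `^ ex w)) 0 D)).
    apply: vsum_le_itv => // u v _ _ _; apply: powR_le_double => //.
    - by rewrite -{1}(subrK (Z u v w) (X i u v w)) ler_normD.
    - exact: ltW (ex_gt0 lw).
    - exact: ex_le.
  rewrite vsumZ vsumD ler_wpM2l// lerD//; last exact: Zbnd.
  apply: dist1 => //; apply: le_trans (Hn i ni) _.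
  by rewrite lee_fin ge_min lexx.
exists n => i j ni nj.
pose psi w u v := `|X i u v w| `^ ex w + `|X j u v w| `^ ex w +
  (`|X i u v w - X j u v w| / eps) `^ ex w.
pose phi u v := \sum_(k < Num.truncn p) \sum_(w : k.+1.-tuple 'I_d) psi w u v.
have psi0 w u v : 0 <= psi w u v by rewrite !addr_ge0 ?powR_ge0.
have phi0 u v : 0 <= phi u v.
  by apply: sumr_ge0 => k _; apply: sumr_ge0.
have psiM w D : low w -> itv_partition 0 T D -> vsum (psi w) 0 D <= M3.
  move=> lw DT; rewrite !vsumD !lerD ?Xbnd//.
  apply: (@le_trans _ _ (vsum (fun u v => c2 *
    ((`|X i u v w - Z u v w| / eps) `^ ex w +
     (`|X j u v w - Z u v w| / eps) `^ ex w)) 0 D)); last first.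
    by rewrite vsumZ vsumD ler_wpM2l// lerD// disteps.
  apply: vsum_le_itv => // u v _ _ _.
  apply: powR_le_double; rewrite ?(ltW (ex_gt0 lw)) ?divr_ge0 ?(ltW eps0) ?ex_le//.
  rewrite -mulrDl ler_wpM2r ?invr_ge0 ?(ltW eps0)//.
  rewrite -[`|X j u v w - _|]normrN opprB.
  by apply: le_trans (ler_normD _ _); rewrite addrA subrK.
have phiM D : itv_partition 0 T D -> vsum phi 0 D <= M.
  move=> DT; rewrite /phi vsum_sum; apply: ler_sum => k _.
  rewrite vsum_sum; apply: ler_sum => w _; apply: psiM => //.
  by rewrite /low size_tuple /= ltn_ord.
have com := control_var phi0 phiM.
exists (var phi); split => //; first exact: var_le phiM (ltW T0).
have psi_var w s t : low w -> 0 <= s -> s < t -> t <= T -> psi w s t <= var phi s t.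
  move=> lw s0 st tT; apply: le_trans (le_var phi0 phiM s0 st tT).
  have /andP[w0 wp] := lw.
  have [k wk] : exists k, size w = k.+1 by exists (size w).-1; rewrite prednK.
  have kp : (k < Num.truncn p)%N by rewrite -wk.
  have wk' : size w == k.+1 by rewrite wk.
  rewrite /phi (bigD1 (Ordinal kp))//= (bigD1 (Tuple wk'))//= -addrA lerDl.
  rewrite addr_ge0// sumr_ge0// => k' _; exact: sumr_ge0.
have root w a s t : low w -> 0 <= s -> s < t -> t <= T -> 0 <= a ->
    a `^ ex w <= psi w s t -> a <= (var phi s t `^ p^-1) ^+ size w.
  move=> lw s0 st tT a0 apsi.
  have v0 : 0 <= var phi s t by apply: (control_ge0 com) => //; exact: ltW.
  have -> : a = (a `^ ex w) `^ (p^-1 * (size w)%:R).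
    rewrite -powRrM /ex (_ : _ * _ = 1) ?powRr1//; field.
    by rewrite !gt_eqF ?low_gt0.
  rewrite -[leRHS]powR_mulrn ?powR_ge0// -[leRHS]powRrM.
  apply: ge0_ler_powR; rewrite ?nnegrE ?powR_ge0//.
    by rewrite mulr_ge0// invr_ge0 ltW.
  exact: le_trans apsi (psi_var _ _ _ lw s0 st tT).
have lowb s t w : 0 <= s -> s <= t -> t <= T -> low w ->
  [/\ `|X i s t w| <= (var phi s t `^ p^-1) ^+ size w,
      `|X j s t w| <= (var phi s t `^ p^-1) ^+ size w &
      `|X i s t w - X j s t w| <= eps * (var phi s t `^ p^-1) ^+ size w].
  move=> s0 st tT lw; have r0 : 0 <= (var phi s t `^ p^-1) ^+ size w.
    by rewrite exprn_ge0 ?powR_ge0.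
  move: st; rewrite le_eqVlt => /orP[/eqP tE|st].
    have Xd k : X k s t w = 0.
      rewrite -tE; case: (w) lw => // a v _; apply: (lmf_diag (XL k)) => //.
      by rewrite tE.
    by rewrite !Xd subr0 normr0; split=> //; rewrite mulr_ge0// ltW.
  split; [apply: root => //|apply: root => //|].
  - by rewrite /psi -addrA lerDl addr_ge0 ?powR_ge0.
  - by rewrite /psi -addrA addrCA lerDl addr_ge0 ?powR_ge0.
  - rewrite mulrC -ler_pdivrMr//; apply: root; rewrite ?divr_ge0 ?(ltW eps0)//.
    by rewrite /psi lerDr addr_ge0 ?powR_ge0.
pose L' := Num.max (L i) (L j).
have widen k : L k <= L' -> lipschitz_mf T L' (X k).
  move=> LL'; have L0 := lmf_ge0 (XL k); split.
  - exact: le_trans LL'.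
  - exact: (lmf_nil (XL k)).
  - exact: (lmf_chen (XL k)).
  - move=> s t w s0 st tT; apply: le_trans (lmf_le (XL k) w s0 st tT) _.
    have ts : 0 <= t - s by rewrite subr_ge0.
    by rewrite lerXn2r ?nnegrE ?mulr_ge0 ?ler_wpM2r// (le_trans L0).
have iL : lipschitz_mf T L' (X i) by apply: widen; rewrite le_max lexx.
have jL : lipschitz_mf T L' (X j) by apply: widen; rewrite le_max lexx orbT.
move=> s t w s0 st tT w0.
by have [] := extension_estimate p1 (ltW eps0) com iL jL lowb s0 st tT w0.
Qed.

End UniformEstimate.

(** * Lipschitz dependence on the endpoints *)

Section LipschitzContinuity.
Context {R : realType} {d : nat}.
Implicit Types (s t u : R) (w : seq 'I_d).

Lemma lmf_increment T L (x : R -> R -> tseries R d) w : lipschitz_mf T L x ->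
  exists2 C, 0 <= C & forall s t u, 0 <= s -> s <= t -> t <= u -> u <= T ->
  `|x s u w - x t u w| <= C * (t - s) /\ `|x s u w - x s t w| <= C * (u - t).
Proof.
move=> xL; have L0 := lmf_ge0 xL.
case wE : (size w) => [|k].
  exists 0 => // s t u s0 st tu uT.
  have su := le_trans st tu; have t0 := le_trans s0 st; have tT := le_trans tu uT.
  by rewrite (size0nil wE) !(lmf_nil xL)// subrr normr0 !mul0r.
have [T0|T0] := ltP T 0.
  by exists 0 => // s t u s0 st tu uT; exfalso; lra.
pose B := L * (L * T) ^+ k.
have LT0 : 0 <= L * T by rewrite mulr_ge0.
have B0 : 0 <= B by rewrite mulr_ge0// exprn_ge0.
have step s t v a : 0 <= s -> s <= t -> t <= T -> size v = a.+1 ->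
    `|x s t v| <= L * (t - s) * (L * T) ^+ a.
  move=> s0 st tT va; have := lmf_le xL v s0 st tT; rewrite va exprS => H.
  apply: le_trans H _; have ts : 0 <= t - s by rewrite subr_ge0.
  rewrite ler_wpM2l ?mulr_ge0// lerXn2r ?nnegrE ?mulr_ge0 ?ler_wpM2l//; lra.
exists (B *+ k.+1); first by rewrite mulrn_wge0.
move=> s t u s0 st tu uT; have tT := le_trans tu uT; have t0 := le_trans s0 st.
have xst1 : x s t [::] = 1 by apply: (lmf_nil xL).
have xtu1 : x t u [::] = 1 by apply: (lmf_nil xL).
have -> : x s u w = x t u w +
    \sum_(i < k) x s t (take i.+1 w) * x t u (drop i.+1 w) + x s t w.
  by rewrite (lmf_chen xL s0 st tu uT) (tprod_mid xst1 xtu1 wE).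
set m := \sum_(i < k) _.
have mid (c : R) : (forall i : 'I_k, `|x s t (take i.+1 w) * x t u (drop i.+1 w)|
    <= B * c) -> `|m| <= B * c *+ k.
  move=> H; apply: le_trans (ler_norm_sum _ _ _) _.
  by apply: le_trans (ler_sum _ (fun i _ => H i)) _; rewrite sumr_const card_ord.
have expE (i : 'I_k) : (L * T) ^+ i * (L * T) ^+ (k - i) = (L * T) ^+ k.
  by rewrite -exprD subnKC// ltnW.
have sizes (i : 'I_k) : size (take i.+1 w) = i.+1 /\
    size (drop i.+1 w) = (k - i)%N.
  by rewrite size_drop size_takel wE ?subSS// ltnW// ltnS.
split.
- have -> : x t u w + m + x s t w - x t u w = m + x s t w by ring.
  apply: le_trans (ler_normD _ _) _; rewrite mulrnAl mulrSr.
  apply: lerD; last by rewrite /B mulrAC; exact: step.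
  apply: mid => i; have [E1 E2] := sizes i; rewrite normrM.
  have -> : B * (t - s) = L * (t - s) * (L * T) ^+ i * (L * T) ^+ (k - i).
    by rewrite -mulrA expE /B mulrAC.
  apply: ler_pM => //; first exact: step.
  by rewrite -E2; exact: (lmf_bounded xL).
- have -> : x t u w + m + x s t w - x s t w = m + x t u w by ring.
  apply: le_trans (ler_normD _ _) _; rewrite mulrnAl mulrSr.
  apply: lerD; last by rewrite /B mulrAC; exact: step.
  apply: mid => i; have [E1 E2] := sizes i; rewrite normrM mulrC.
  have ki : (k - i = (k - i.+1).+1)%N by rewrite -subSn.
  have -> : B * (u - t) =
      L * (u - t) * (L * T) ^+ (k - i.+1) * (L * T) ^+ i.+1.
    by rewrite /B -[RHS]mulrA -exprD subnK// mulrAC.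
  apply: ler_pM => //; first by apply: step; rewrite // E2 ki.
  by rewrite -[in leRHS]E1; exact: (lmf_bounded xL).
Qed.

(** Both intervals are compared with the smallest interval containing them, so that no pair of
    endpoints leaves the simplex. *)
Lemma lmf_lipschitz T L (x : R -> R -> tseries R d) w : lipschitz_mf T L x ->
  exists2 C, 0 <= C & forall s t s' t', 0 <= s -> s <= t -> t <= T ->
    0 <= s' -> s' <= t' -> t' <= T ->
  `|x s t w - x s' t' w| <= C * (`|s - s'| + `|t - t'|).
Proof.
move=> xL; have [C C0 HC] := lmf_increment w xL.
exists (C * 2); first by rewrite mulr_ge0.
have half s t s' t' : 0 <= s -> s <= t -> t <= T -> 0 <= s' -> s' <= t' ->
    t' <= T -> `|x s t w - x (Num.min s s') (Num.max t t') w| <=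
    C * (`|s - s'| + `|t - t'|).
  move=> s0 st tT s'0 st' tT'; set m := Num.min _ _; set M := Num.max _ _.
  have m0 : 0 <= m by rewrite le_min s0.
  have ms : m <= s by rewrite ge_min lexx.
  have tM : t <= M by rewrite le_max lexx.
  have MT : M <= T by rewrite ge_max tT.
  have [H1 _] := HC m s t m0 ms st tT.
  have [_ H2] := HC m t M m0 (le_trans ms st) tM MT.
  have -> : x s t w - x m M w = (x s t w - x m t w) + (x m t w - x m M w) by ring.
  apply: le_trans (ler_normD _ _) _; rewrite mulrDr; apply: lerD.
    rewrite distrC; apply: le_trans H1 _; apply: ler_wpM2l => //.
    by rewrite /m; case: (leP s s') => h; rewrite ?subrr// ler_norm.
  rewrite distrC; apply: le_trans H2 _; apply: ler_wpM2l => //.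
  by rewrite /M distrC; case: (leP t t') => h; rewrite ?subrr// ler_norm.
move=> s t s' t' s0 st tT s'0 st' tT'.
have H1 := half s t s' t' s0 st tT s'0 st' tT'.
have H2 := half s' t' s t s'0 st' tT' s0 st tT.
rewrite mulrAC mulr_natr mulr2n.
rewrite -[x s t w](subrK (x (Num.min s s') (Num.max t t') w)) -addrA.
apply: le_trans (ler_normD _ _) _; apply: lerD => //.
by rewrite distrC minC maxC [`|s - _|]distrC [`|t - _|]distrC.
Qed.

End LipschitzContinuity.

(** * The limit of the signatures *)

Section LimitFunctional.
Context {R : realType} {d : nat}.
Variables (T p : R) (X : nat -> R -> R -> tseries R d).
Variables (L : nat -> R) (M : R).
Hypothesis T0 : 0 < T.
Hypothesis p1 : 1 < p.
Hypothesis XL : forall m, lipschitz_mf T (L m) (X m).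
Hypothesis M0 : 0 <= M.
Implicit Types (s t u v : R) (w : seq 'I_d) (D : seq R).

Hypothesis XM : forall eps, 0 < eps -> exists n, forall i j,
  (n <= i)%N -> (n <= j)%N ->
  exists om, [/\ control T om, om 0 T <= M &
  forall s t w, 0 <= s -> s <= t -> t <= T -> (0 < size w)%N ->
  `|X i s t w| <= level_cst p (size w) * (om s t `^ p^-1) ^+ size w /\
  `|X i s t w - X j s t w| <=
    eps * (level_cst p (size w) * (om s t `^ p^-1) ^+ size w)].

Let p0 : 0 < p. Proof. exact: lt_trans p1. Qed.

Definition limit_functional s t w : R := limn (fun m => X m s t w).
Local Notation S := limit_functional.

Let root_le om s t k : control T om -> om 0 T <= M -> 0 <= s -> s <= t ->
  t <= T -> (om s t `^ p^-1) ^+ k <= (M `^ p^-1) ^+ k.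
Proof.
move=> com omM s0 st tT; rewrite lerXn2r ?nnegrE ?powR_ge0//.
apply: ge0_ler_powR; rewrite ?nnegrE ?invr_ge0 ?(ltW p0)//.
  exact: (control_ge0 com).
by apply: le_trans omM; exact: (control_mono com).
Qed.

Let K k := level_cst p k * (M `^ p^-1) ^+ k.

Let K_ge0 k : 0 <= K k.
Proof. by rewrite mulr_ge0 ?level_cst_ge0// exprn_ge0 ?powR_ge0. Qed.

Let X_cauchy w e : 0 < e -> exists n, forall i j, (n <= i)%N -> (n <= j)%N ->
  forall s t, 0 <= s -> s <= t -> t <= T -> `|X i s t w - X j s t w| <= e.
Proof.
move=> e0; have [w0|w0] := posnP (size w).
  exists 0%N => i j _ _ s t s0 st tT.
  by rewrite (size0nil w0) !(lmf_nil (XL _))// subrr normr0 ltW.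
have K1 : 0 < K (size w) + 1 by rewrite ltr_wpDl.
have [|n Hn] := XM (eps := e / (K (size w) + 1)); first by rewrite divr_gt0.
exists n => i j ni nj s t s0 st tT.
have [om [com omM H]] := Hn i j ni nj.
have [_ H2] := H s t w s0 st tT w0; apply: le_trans H2 _.
apply: (@le_trans _ _ (e / (K (size w) + 1) * K (size w))).
  rewrite ler_wpM2l ?divr_ge0 ?(ltW e0) ?(ltW K1)//.
  by rewrite ler_wpM2l ?level_cst_ge0// root_le.
by rewrite mulrAC ler_pdivrMr// ler_wpM2l ?(ltW e0)// lerDl.
Qed.

Lemma limit_functional_cvg s t w : 0 <= s -> s <= t -> t <= T ->
  X m s t w @[m --> \oo] --> S s t w.
Proof.
move=> s0 st tT; apply: cvgn_cauchy => e e0.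
by have [n Hn] := X_cauchy w e0; exists n => i j ni nj; exact: Hn.
Qed.

Let X_unif w e : 0 < e -> exists n, forall i, (n <= i)%N ->
  forall s t, 0 <= s -> s <= t -> t <= T -> `|X i s t w - S s t w| <= e.
Proof.
move=> e0; have [n Hn] := X_cauchy w e0; exists n => i ni s t s0 st tT.
apply: (@ler_cvg_to _ \oo _ _ (fun j => `|X i s t w - X j s t w|) (fun=> e)).
- apply: cvg_norm; apply: cvgB; first exact: cvg_cst.
  exact: limit_functional_cvg.
- exact: cvg_cst.
- by exists n => // j nj; exact: Hn.
Qed.

Lemma limit_functional_nil s t : 0 <= s -> s <= t -> t <= T -> S s t [::] = 1.
Proof.
move=> s0 st tT; apply: cvg_lim => //.
by under eq_fun do rewrite (lmf_nil (XL _) s0 st tT); exact: cvg_cst.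
Qed.

Lemma limit_functional_chen s t u : 0 <= s -> s <= t -> t <= u -> u <= T ->
  S s u = tprod (S s t) (S t u).
Proof.
move=> s0 st tu uT; have t0 := le_trans s0 st; have tT := le_trans tu uT.
apply/funext => w; apply: cvg_lim => //.
under eq_fun do rewrite (lmf_chen (XL _) s0 st tu uT).
by apply: cvgn_sum => i; apply: cvgM; exact: limit_functional_cvg.
Qed.

Lemma limit_functional_group_like s t : 0 <= s -> s <= t -> t <= T ->
  group_like (S s t).
Proof.
move=> s0 st tT; split=> [|v w]; first exact: limit_functional_nil.
have H1 : X m s t v * X m s t w @[m --> \oo] --> S s t v * S s t w.
  by apply: cvgM; exact: limit_functional_cvg.
have H2 : X m s t v * X m s t w @[m --> \oo] -->
    \sum_(u <- shuffle v w) S s t u.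
  under eq_fun do rewrite (lmf_shuffle (XL _) _ _ s0 st tT).
  by apply: cvgn_sum => u; exact: limit_functional_cvg.
by rewrite -(cvg_lim _ H1)// -(cvg_lim _ H2).
Qed.

(** A uniform limit of functionals that are Lipschitz in the endpoints; the Lipschitz constant of a
    single [X n] is enough. *)
Lemma limit_functional_continuous w :
  {within [set z : R * R | [&& 0 <= z.1, z.1 <= z.2 & z.2 <= T]],
    continuous (fun z : R * R => S z.1 z.2 w)}.
Proof.
apply/subspace_continuousP => -[s t] /= /and3P[s0 st tT].
apply/cvgrPdist_le => e e0.
have [|n Hn] := X_unif w (e := e / 3); first by rewrite divr_gt0.
have [C C0 HC] := lmf_lipschitz w (XL n).
pose del := e / 3 / (2 * (C + 1)).
have C1 : 0 < C + 1 by rewrite ltr_wpDl.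
have del0 : 0 < del by rewrite !divr_gt0// mulr_gt0.
have N1 : \forall z \near (s, t), `|s - z.1| <= del.
  have zc : z.1 @[z --> (s, t)] --> s by exact: cvg_fst.
  by move/cvgrPdist_le : zc; exact.
have N2 : \forall z \near (s, t), `|t - z.2| <= del.
  have zc : z.2 @[z --> (s, t)] --> t by exact: cvg_snd.
  by move/cvgrPdist_le : zc; exact.
rewrite near_withinE; near=> z => /= /and3P[z0 z12 zT].
have -> : S s t w - S z.1 z.2 w = (S s t w - X n s t w) +
  (X n s t w - X n z.1 z.2 w) + (X n z.1 z.2 w - S z.1 z.2 w) by ring.
have -> : e = e / 3 + e / 3 + e / 3 by field.
apply: le_trans (ler_normD _ _) _; apply: lerD; last exact: Hn.
apply: le_trans (ler_normD _ _) _; apply: lerD; first by rewrite distrC; exact: Hn.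
apply: le_trans (HC _ _ _ _ s0 st tT z0 z12 zT) _.
apply: (@le_trans _ _ ((C + 1) * (del + del))); last first.
  by rewrite /del le_eqVlt; apply/orP; left; apply/eqP; field; rewrite gt_eqF.
apply: ler_pM => //; first by rewrite lerDl.
by apply: lerD; near: z.
Unshelve. all: by end_near. Qed.

Lemma limit_functional_multiplicative : multiplicative_functional T S.
Proof.
split; [exact: limit_functional_nil|exact: limit_functional_chen|].
exact: limit_functional_continuous.
Qed.

(** Stated for an arbitrary sequence in order to serve both for [X i], with c = 1, and for
    [X i - X j] with [i] fixed, with c small. The control varies with the index and disappears
    through its mass before the limit is taken. *)
Let vsum_level_limit k c (x : nat -> R -> R -> tseries R d)
    (y : R -> R -> tseries R d) D : (0 < k)%N -> 0 <= c ->
  (exists n, forall i, (n <= i)%N -> exists om, [/\ control T om, om 0 T <= M &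
    forall s t w, 0 <= s -> s <= t -> t <= T -> size w = k ->
    `|x i s t w| <= c * (level_cst p k * (om s t `^ p^-1) ^+ k)]) ->
  (forall s t w, 0 <= s -> s <= t -> t <= T ->
    x i s t w @[i --> \oo] --> y s t w) ->
  itv_partition 0 T D ->
  vsum (fun u v => level_norm k (y u v) `^ (p / k%:R)) 0 D <=
  (c * (d%:R ^+ k * level_cst p k)) `^ (p / k%:R) * M.
Proof.
move=> k0 c0 [n Hn] xy DT; have [Dp /eqP lD] := DT.
have kR : 0 < k%:R :> R by rewrite ltr0n.
apply: (@ler_cvg_to _ \oo _ _
  (fun i => vsum (fun u v => level_norm k (x i u v) `^ (p / k%:R)) 0 D) (fun=> _)).
- apply: (@cvgn_vsum _ _ _ 0 T D) => //; [exact: path_ltW|by rewrite lD|].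
  move=> u v u0 uv vT; apply: cvgn_powR; first by rewrite divr_gt0.
    by move=> i; exact: level_norm_ge0.
  by apply: cvgn_level_norm => w; exact: xy.
- exact: cvg_cst.
exists n => // i ni; have [om [com omM H]] := Hn i ni.
have c'0 : 0 <= c * (d%:R ^+ k * level_cst p k).
  by rewrite mulr_ge0// mulr_ge0 ?exprn_ge0 ?level_cst_ge0.
have [c' c'E] : exists c', c' = c * (d%:R ^+ k * level_cst p k) by eexists.
rewrite -c'E in c'0 *.
apply: (@le_trans _ _ (vsum (fun u v => c' `^ (p / k%:R) * om u v) 0 D)).
  apply: (vsum_le_itv DT) => u v u0 uv vT.
  have om0 : 0 <= om u v by exact: (control_ge0 com).
  have -> : c' `^ (p / k%:R) * om u v =
      (c' * (om u v `^ p^-1) ^+ k) `^ (p / k%:R).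
    rewrite powRM ?exprn_ge0 ?powR_ge0//; congr (_ * _).
    rewrite -powR_mulrn ?powR_ge0// -!powRrM (_ : p^-1 * _ = 1) ?powRr1//.
    by field; rewrite !gt_eqF.
  apply: ge0_ler_powR; rewrite ?nnegrE ?level_norm_ge0//.
  - by rewrite divr_ge0// ltW.
  - by rewrite mulr_ge0// exprn_ge0 ?powR_ge0.
  have B0 : 0 <= c * (level_cst p k * (om u v `^ p^-1) ^+ k).
    by rewrite mulr_ge0// mulr_ge0 ?level_cst_ge0 ?exprn_ge0 ?powR_ge0.
  apply: le_trans (level_norm_le B0 (fun w => H u v w u0 uv vT)) _.
  by rewrite le_eqVlt c'E; apply/orP; left; apply/eqP; ring.
rewrite vsumZ; apply: ler_wpM2l; first exact: powR_ge0.
apply: le_trans omM; rewrite -lD; apply: (control_vsum com) => //.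
  exact: path_ltW.
by rewrite lD.
Qed.

Let root_pvar k c : (0 < k)%N -> 0 <= c ->
  (c `^ (p / k%:R) * M) `^ (k%:R / p) = c * M `^ (k%:R / p).
Proof.
move=> k0 c0; have kR : 0 < k%:R :> R by rewrite ltr0n.
rewrite powRM ?powR_ge0// -powRrM (_ : _ / _ * _ = 1) ?powRr1//.
by field; rewrite !gt_eqF.
Qed.

Lemma limit_functional_pvar k : (0 < k)%N ->
  (pvar p T k S <= (d%:R ^+ k * level_cst p k * M `^ (k%:R / p))%:E)%E.
Proof.
move=> k0; have C0 : 0 <= d%:R ^+ k * level_cst p k.
  by rewrite mulr_ge0 ?exprn_ge0 ?level_cst_ge0.
rewrite -root_pvar//; apply: pvar_dist_le => // D DT.
rewrite -[X in X `^ _ * M]mul1r.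
apply: (@vsum_level_limit k 1 (fun i u v w => X i u v w - 0)) => //.
  have [n Hn] := XM ltr01; exists n => i ni.
  have [om [com omM H]] := Hn i i ni ni; exists om; split => // s t w s0 st tT wk.
  have [|H1 _] := H s t w s0 st tT; first by rewrite wk.
  by rewrite subr0 mul1r -wk.
move=> s t w s0 st tT; rewrite subr0; under eq_fun do rewrite subr0.
exact: limit_functional_cvg.
Qed.

Lemma limit_functional_pvar_dist k eps : (0 < k)%N -> 0 < eps ->
  \forall i \near \oo, (pvar_dist p T k (X i) S <= eps%:E)%E.
Proof.
move=> k0 eps0; set B := d%:R ^+ k * level_cst p k * M `^ (k%:R / p).
have C0 : 0 <= d%:R ^+ k * level_cst p k.
  by rewrite mulr_ge0 ?exprn_ge0 ?level_cst_ge0.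
have B0 : 0 <= B by rewrite mulr_ge0 ?powR_ge0.
have B1 : 0 < B + 1 by rewrite ltr_wpDl.
have e0 : 0 < eps / (B + 1) by rewrite divr_gt0.
have [n Hn] := XM e0; exists n => // i ni.
apply: (@le_trans _ _ ((eps / (B + 1) * (d%:R ^+ k * level_cst p k)) *
    M `^ (k%:R / p))%:E); last first.
  rewrite lee_fin -mulrA -/B mulrAC ler_pdivrMr//.
  by rewrite ler_wpM2l ?(ltW eps0)// lerDl.
rewrite -root_pvar//; last by rewrite mulr_ge0 ?(ltW e0).
apply: pvar_dist_le => // D DT.
apply: (@vsum_level_limit k _ (fun j u v w => X i u v w - X j u v w)) => //.
- exact: ltW.
- exists n => j nj; have [om [com omM H]] := Hn i j ni nj.
  exists om; split => // s t w s0 st tT wk.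
  have [|_ H2] := H s t w s0 st tT; first by rewrite wk.
  by rewrite -wk.
- move=> s t w s0 st tT; apply: cvgB; first exact: cvg_cst.
  exact: limit_functional_cvg.
Qed.

Lemma limit_functional_rp_dist n :
  rp_dist p T n (X m) S @[m --> \oo] --> 0%E.
Proof.
apply/cvge0_le => [i|e e0]; first exact: rp_dist_ge0.
have : \forall i \near \oo, forall k, (k < n)%N ->
    (pvar_dist p T k.+1 (X i) S <= e%:E)%E.
  elim: n => [|n IH]; first exact: nearW.
  move: (limit_functional_pvar_dist (ltn0Sn n) e0); apply: filterS2 IH.
  move=> i H1 H2 k; rewrite ltnS leq_eqVlt => /orP[/eqP ->//|]; exact: H1.
apply: filterS => i H; apply: rp_dist_le; first by rewrite lee_fin ltW.
by case=> // k /andP[_ kn]; exact: H.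
Qed.

End LimitFunctional.

(** * Summability, uniqueness and the theorem *)

Section Summability.
Context {R : realType}.

(** From n0 on, b n * 2^n does not increase, so its first n0 + 1 values bound it. *)
Lemma ratio_half_geometric (b : nat -> R) n0 : (forall n, 0 <= b n) ->
  (forall n, (n0 <= n)%N -> b n.+1 <= b n / 2) ->
  exists2 C, 0 <= C & forall n, b n <= C / 2 ^+ n.
Proof.
move=> b0 H; have pos i : 0 <= b i * 2 ^+ i by rewrite mulr_ge0// exprn_ge0.
exists (\sum_(i < n0.+1) b i * 2 ^+ i); first exact: sumr_ge0.
have small n : (n <= n0)%N -> b n * 2 ^+ n <= \sum_(i < n0.+1) b i * 2 ^+ i.
  move=> nn0; have nn0' : (n < n0.+1)%N by [].
  by rewrite (bigD1 (Ordinal nn0'))//= lerDl sumr_ge0.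
move=> n; rewrite ler_pdivlMr ?exprn_gt0//.
elim: n => [|n IH]; first exact: small.
have [n0n|nn0] := leqP n0 n; last exact: small.
apply: le_trans IH; rewrite exprS mulrCA mulrA [2 * _]mulrC.
rewrite ler_wpM2r ?exprn_ge0//.
by rewrite -ler_pdivlMr//; exact: H.
Qed.

Lemma sum_geometric_half (C : R) n : 0 <= C ->
  \sum_(1 <= k < n) C / 2 ^+ k <= C.
Proof.
move=> C0; case: n => [|n]; first by rewrite big_geq.
suff -> : \sum_(1 <= k < n.+1) C / 2 ^+ k = C - C / 2 ^+ n.
  by rewrite gerBl divr_ge0// exprn_ge0.
elim: n => [|n IH]; first by rewrite big_geq// expr0 divr1 subrr.
by rewrite big_nat_recr//= IH exprS; field; rewrite expf_neq0.
Qed.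

(** Without the weight k^-2, the ratio of consecutive terms is x K / (n + 1)^(1/p), with K =
    [level_base p]. It is at most 1/2 once n + 1 reaches (2 x K)^p, whence [y] and the threshold. *)
Lemma level_cst_geometric (p x : R) : 1 < p -> 0 <= x ->
  exists2 C, 0 <= C & forall n, (0 < n)%N ->
    x ^+ n * level_cst p n <= C / 2 ^+ n.
Proof.
move=> p1 x0; have p0 : 0 < p := lt_trans ltr01 p1.
have F0 := fact_root_gt0 p; have B0 := level_beta_gt0 p1.
have K0 : 0 <= level_base p by apply: le_trans (level_base_ge1 p1).
pose b n := (x * level_base p) ^+ n / (fact_root p n * level_beta p).
have b0 n : 0 <= b n.
  by rewrite divr_ge0 ?exprn_ge0 ?mulr_ge0// ltW.
pose y := 2 * (x * level_base p).
have y0 : 0 <= y by rewrite !mulr_ge0.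
have [C C0 HC] : exists2 C, 0 <= C & forall n, b n <= C / 2 ^+ n.
  apply: (@ratio_half_geometric b (Num.truncn (y `^ p))) => // n ny.
  have yn : y <= n.+1%:R `^ p^-1.
    have -> : y = (y `^ p) `^ p^-1 by rewrite -powRrM divff ?powRr1// gt_eqF.
    apply: ge0_ler_powR; rewrite ?nnegrE ?powR_ge0//; first by rewrite invr_ge0 ltW.
    by apply: ltW; apply: lt_le_trans (truncnS_gt _) _; rewrite ler_nat.
  have r0 : 0 < n.+1%:R `^ p^-1 :> R by rewrite powR_gt0.
  have -> : b n.+1 = b n / 2 * (y / n.+1%:R `^ p^-1).
    rewrite /b /y exprS /fact_root factS natrM powRM//.
    have f0 : 0 < (n`!)%:R `^ p^-1 :> R := F0 n.
    by field; rewrite !gt_eqF.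
  by apply: ler_piMr; [rewrite divr_ge0|rewrite ler_pdivrMr// mul1r].
exists C => // n n0; apply: le_trans (HC n).
rewrite /b exprMn /level_cst -[leRHS]mulrA; apply: ler_wpM2l; first exact: exprn_ge0.
apply: ler_wpM2l; first exact: exprn_ge0.
have n1 : 1 <= n%:R :> R by rewrite ler1n.
rewrite lef_pV2 ?posrE ?mulr_gt0 ?exprn_gt0 ?(lt_le_trans ltr01 n1)//.
by rewrite ler_peMr ?mulr_ge0 ?(ltW (F0 n)) ?(ltW B0)// expr_ge1// (le_trans ler01).
Qed.

(** The dimension and the mass contribute the geometric factor (d M^(1/p))^n, which the factorial
    outweighs. *)
Lemma pvar_summable (d : nat) (T p M : R) (S : R -> R -> tseries R d) :
  0 < T -> 1 < p -> 0 <= M ->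
  (forall k, (0 < k)%N ->
    (pvar p T k S <= (d%:R ^+ k * level_cst p k * M `^ (k%:R / p))%:E)%E) ->
  (\sum_(1 <= n <oo) pvar p T n S < +oo)%E.
Proof.
move=> T0 p1 M0 HS.
have x0 : 0 <= d%:R * M `^ p^-1 by rewrite mulr_ge0 ?powR_ge0.
have [C C0 HC] := level_cst_geometric p1 x0.
have pv0 n : (0 <= pvar p T n S)%E by exact: pvar_dist_ge0.
apply: (@le_lt_trans _ _ C%:E); last exact: ltry.
apply: lime_le; first by apply: is_cvg_nneseries => n _ _; exact: pv0.
apply: nearW => n.
apply: (@le_trans _ _ (\sum_(1 <= k < n) (C / 2 ^+ k)%:E)%E); last first.
  by rewrite sumEFin lee_fin sum_geometric_half.
rewrite big_nat [leRHS]big_nat; apply: lee_sum => k /andP[k0 _].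
apply: le_trans (HS k k0) _; rewrite lee_fin; apply: le_trans (HC k k0).
have E : (M `^ p^-1) ^+ k = M `^ (k%:R / p).
  by rewrite -powR_mulrn ?powR_ge0// -powRrM mulrC.
by rewrite exprMn E mulrAC.
Qed.

End Summability.

(** * Uniqueness of the extension *)

Section Uniqueness.
Context {R : realType}.
Implicit Types (s t : R) (f : R -> R).

(** Cutting where [f] takes the mean of its end values yields twice as many increments of half the
    size, hence a factor 2 * 2^-q at each of the [j] rounds. *)
Lemma powR_lt1_variation f (q : R) j s t : s < t -> f s != f t ->
  {within `[s, t], continuous f} -> exists D, itv_partition s t D /\
  (2 `^ (1 - q)) ^+ j * `|f t - f s| `^ q <=
    vsum (fun u v => `|f v - f u| `^ q) s D.
Proof.
elim: j s t => [|j IH] s t st fst fc.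
  exists [:: t]; split; first exact: itv_partition1.
  by rewrite /= addr0 expr0 mul1r.
pose m := (f s + f t) / 2.
have [|z] := @IVT R f s t m (ltW st) fc.
  by rewrite /m ge_min le_max; case: (leP (f s) (f t)) => h; apply/andP; split;
    apply/orP; (try by left; lra); right; lra.
rewrite in_itv/= => /andP[sz zt] fz.
have zs : s != z.
  by apply: contra_neq fst => E; move: fz; rewrite -E /m => h; lra.
have zt' : z != t.
  by apply: contra_neq fst => E; move: fz; rewrite E /m => h; lra.
have sz' : s < z by rewrite lt_neqAle zs.
have zt2 : z < t by rewrite lt_neqAle zt'.
have fsz : f s != f z.
  by apply: contra_neq fst; rewrite fz /m => h; lra.
have fzt : f z != f t.
  by apply: contra_neq fst; rewrite fz /m => h; lra.
have [|D1 [P1 V1]] := IH s z sz' fsz.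
  by apply: continuous_subspaceW fc; apply: subset_itvl; rewrite bnd_simp.
have [|D2 [P2 V2]] := IH z t zt2 fzt.
  by apply: continuous_subspaceW fc; apply: subset_itvr; rewrite bnd_simp.
exists (D1 ++ D2); split; first exact: itv_partition_cat P1 P2.
rewrite vsum_cat; case: P1 => _ /eqP ->; apply: le_trans (lerD V1 V2).
have -> : f z - f s = (f t - f s) / 2 by rewrite fz /m; field.
have -> : f t - f z = (f t - f s) / 2 by rewrite fz /m; field.
rewrite normrM (@ger0_norm _ 2^-1) ?invr_ge0// powRM ?invr_ge0//.
have E : 2 `^ (1 - q) = 2 * 2^-1 `^ q :> R.
  rewrite powRD ?pnatr_eq0 ?implybT// powRr1// powRN; congr (_ * _).
  by rewrite -[in RHS](powR_inv1 (ler0n _ 2)) -powRrM mulN1r powRN.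
by rewrite exprS {1}E le_eqVlt; apply/orP; left; apply/eqP; ring.
Qed.

Lemma powR_lt1_variation_cst f (q C : R) s t : 0 < q -> q < 1 -> s < t ->
  {within `[s, t], continuous f} ->
  (forall D, itv_partition s t D ->
    vsum (fun u v => `|f v - f u| `^ q) s D <= C) ->
  f s = f t.
Proof.
move=> q0 q1 st fc HC; apply: contrapT => /eqP fst.
have r1 : 1 < 2 `^ (1 - q) :> R.
  rewrite -[ltLHS](powRr0 2) /powR pnatr_eq0/= ltr_expR mul0r.
  by rewrite mulr_gt0 ?subr_gt0// ln_gt0// ltr1n.
have r0 : 0 < 2 `^ (1 - q) :> R := lt_trans ltr01 r1.
have D0 : 0 < `|f t - f s| by rewrite normr_gt0 subr_eq0 eq_sym.
have H j : `|f t - f s| `^ q <= C * (2 `^ (1 - q))^-1 ^+ j.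
  have [D [P V]] := powR_lt1_variation q j st fst fc.
  by rewrite exprVn ler_pdivlMr ?exprn_gt0// mulrC; apply: le_trans V (HC D P).
have : `|f t - f s| `^ q <= C * 0.
  apply: (@ler_cvg_to _ \oo _ _ (fun=> _) (fun j => C * (2 `^ (1 - q))^-1 ^+ j)).
  - exact: cvg_cst.
  - apply: cvgM; first exact: cvg_cst.
    by apply: cvg_expr; rewrite ger0_norm ?invr_ge0 ?ltW// invf_lt1.
  - exact: nearW.
by rewrite mulr0 leNgt powR_gt0.
Qed.

Lemma simplex_continuous_section (d : nat) T (S : R -> R -> tseries R d) w :
  multiplicative_functional T S ->
  {within `[0, T], continuous (fun t => S 0 t w)}.
Proof.
move=> [_ _ /(_ w)/subspace_continuousP Sc]; apply/subspace_continuousP.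
move=> t; rewrite /= in_itv/= => /andP[t0 tT].
have At : [set x : R * R | [&& 0 <= x.1, x.1 <= x.2 & x.2 <= T]] (0, t).
  by rewrite /= lexx t0.
apply: (cvg_comp (fun v => (0, v)) (fun z : R * R => S z.1 z.2 w) _ (Sc _ At)).
have c : ((0 : R), v) @[v --> t] --> ((0 : R), t).
  exact: (cvg_pair (cvg_cst (0 : R)) (@cvg_id _ (nbhs t))).
move=> P HP; change (\forall v \near t, `[0, T]%classic v -> P (0, v)).
have {c}HP : \forall v \near t, [&& 0 <= (0 : R), 0 <= v & v <= T] -> P (0, v).
  exact: (c _ HP).
apply: filterS HP => v Hv.
by rewrite /= in_itv/= => /andP[v0 vT]; apply: Hv; rewrite /= lexx v0.
Qed.

Lemma pvar_word_bounded (d : nat) p T (S : R -> R -> tseries R d) w :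
  0 < p -> 0 < T -> (0 < size w)%N -> (pvar p T (size w) S < +oo)%E ->
  exists C, forall D, itv_partition 0 T D ->
  vsum (fun u v => `|S u v w| `^ (p / (size w)%:R)) 0 D <= C.
Proof.
move=> p0 T0 w0 fin; pose e := fine (pvar p T (size w) S).
exists (e `^ (p / (size w)%:R)) => D DT.
have eE : (pvar p T (size w) S <= e%:E)%E.
  by rewrite fineK// ge0_fin_numE// pvar_dist_ge0.
apply: le_trans (pvar_dist_ge p0 w0 eE DT).
apply: (vsum_le_itv DT) => u v _ _ _.
apply: ge0_ler_powR; rewrite ?nnegrE ?level_norm_ge0 ?divr_ge0 ?(ltW p0)//.
by rewrite -[S u v w]subr0; exact: (le_level_norm (fun w => S u v w - 0)).
Qed.

(* Two extensions that agree below level n differ at level n by an additive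
   functional; its finite variation of order p / n < 1 makes it vanish. *)
Lemma lyons_extension_unique (d : nat) p T (X S S' : R -> R -> tseries R d) :
  0 < p -> 0 < T -> lyons_extension p T X S -> lyons_extension p T X S' ->
  forall s t, 0 <= s -> s <= t -> t <= T -> S' s t = S s t.
Proof.
move=> p0 T0 [Sm Sp SX] [Sm' Sp' SX'].
suff H n : forall w s t, (size w < n)%N -> 0 <= s -> s <= t -> t <= T ->
    S' s t w = S s t w.
  by move=> s t s0 st tT; apply/funext => w; exact: (H (size w).+1).
elim: n => // n IH w; have [wp|pw] := leqP (size w) (Num.truncn p).
  by move=> s t _ s0 st tT; rewrite SX ?SX'.
move=> s t wn; have w0 : (0 < size w)%N by apply: leq_ltn_trans pw.
have wR : 0 < (size w)%:R :> R by rewrite ltr0n.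
have [k wk] : exists k, size w = k.+1 by exists (size w).-1; rewrite prednK.
have kn : (k < n)%N by rewrite -ltnS -wk.
pose q := p / (size w)%:R.
have q0 : 0 < q by rewrite divr_gt0.
have q1 : q < 1.
  rewrite ltr_pdivrMr// mul1r; apply: lt_le_trans (truncnS_gt _) _.
  by rewrite ler_nat.
pose f t := S' 0 t w - S 0 t w.
have [Snil Schen _] := Sm; have [Snil' Schen' _] := Sm'.
(* In Chen's identity on [0, u] and [u, v] the middle terms involve words shorter than [w], so they
   agree by induction and cancel. *)
have fE u v : 0 <= u -> u <= v -> v <= T -> S' u v w - S u v w = f v - f u.
  move=> u0 uv vT; have uT := le_trans uv vT.
  have z0 : 0 <= 0 :> R by [].
  rewrite /f (Schen 0 u v)// (Schen' 0 u v)//.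
  rewrite !(tprod_mid _ _ wk) ?Snil ?Snil'//.
  have -> : \sum_(i < k) S' 0 u (take i.+1 w) * S' u v (drop i.+1 w) =
            \sum_(i < k) S 0 u (take i.+1 w) * S u v (drop i.+1 w).
    apply: eq_bigr => i _; rewrite !IH//.
    - by rewrite size_drop wk subSS (leq_ltn_trans (leq_subr _ _)).
    - rewrite size_takel; first exact: leq_ltn_trans (ltn_ord i) kn.
      by rewrite wk ltnS ltnW.
  ring.
suff fcst u : 0 <= u -> u <= T -> f u = f 0.
  move=> s0 st tT; have t0 := le_trans s0 st; have sT := le_trans st tT.
  by apply/eqP; rewrite -subr_eq0 fE// !fcst// subrr.
move=> u0 uT; move: u0; rewrite le_eqVlt => /orP[/eqP <-//|u0].
have fc : {within `[0, u], continuous f}.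
  apply: (@continuous_subspaceW _ _ _ [set` `[0, T]]).
    by apply: subset_itvl; rewrite bnd_simp.
  move=> x; apply: cvgB; exact: simplex_continuous_section.
have [C HC] := pvar_word_bounded p0 T0 w0 (Sp _ w0).
have [C' HC'] := pvar_word_bounded p0 T0 w0 (Sp' _ w0).
have phi0 (a b : R) : 0 <= 2 `^ q * (`|S' a b w| `^ q + `|S a b w| `^ q).
  by rewrite mulr_ge0 ?addr_ge0 ?powR_ge0.
have phiM D : itv_partition 0 T D ->
    vsum (fun a b => 2 `^ q * (`|S' a b w| `^ q + `|S a b w| `^ q)) 0 D <=
    2 `^ q * (C' + C).
  move=> DT; rewrite vsumZ vsumD; apply: ler_wpM2l; first exact: powR_ge0.
  by apply: lerD; [exact: HC'|exact: HC].
apply/esym/(powR_lt1_variation_cst q0 q1 u0 fc) => D Du.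
apply: le_trans (vsum_bounded phi0 phiM (lexx 0) uT Du).
case: (Du) => Dp /eqP lD; apply: (@vsum_le _ _ _ _ u) => //.
- move=> a b a0 ab bu; have bT := le_trans bu uT.
  apply: powR_le_double => //; last exact: ltW.
  by rewrite -fE// -[`|S a b w|]normrN; exact: ler_normD.
- exact: path_ltW.
- by rewrite lD.
Qed.

End Uniqueness.

Section LowLevels.
Context {R : realType} {d : nat}.
Variables (T p : R) (X : nat -> R -> R -> tseries R d) (Z : R -> R -> tseries R d).
Hypothesis T0 : 0 < T.
Hypothesis p0 : 0 < p.
Hypothesis XZ : rp_dist p T (Num.truncn p) (X m) Z @[m --> \oo] --> 0%E.

(** The single interval [s, t], completed to a partition of [0, T], already bounds the coordinate. A
    degenerate interval occurs in no partition. *)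
Lemma rp_dist_pointwise_cvg (s t : R) w : 0 <= s -> s < t -> t <= T ->
  (0 < size w <= Num.truncn p)%N -> X m s t w @[m --> \oo] --> Z s t w.
Proof.
move=> s0 st tT lw; have /andP[w0 _] := lw; apply/cvgrPdist_le => e e0.
move/cvge0_le : XZ => /(_ (fun i => rp_dist_ge0 _ _ _ _ _) e e0).
apply: filterS => m XZe.
have H := pvar_dist_ge p0 w0 (le_trans (pvar_dist_le_rp_dist _ _ _ _ lw) XZe).
have q0 : 0 < p / (size w)%:R by rewrite divr_gt0// ltr0n.
have := vsum_bounded (fun u v => powR_ge0 _ _) H s0 tT (itv_partition1 st).
rewrite /= addr0 distrC => Hst.
apply: le_trans (le_level_norm (fun w => X m s t w - Z s t w) w) _.
rewrite leNgt; apply/negP => elt.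
have := gt0_ltr_powR q0 _ _ elt; rewrite !nnegrE level_norm_ge0 (ltW e0).
by move=> /(_ isT isT); rewrite ltNge Hst.
Qed.

End LowLevels.

Lemma min_hurst_le1 (R : realType) N (H : 'rV[R]_N) : min_hurst H <= 1.
Proof.
by rewrite /min_hurst; elim/big_rec: _ => // i x _ x1; rewrite ge_min x1 orbT.
Qed.

Theorem proposition6p2 (R : realType) (disp : measure_display)
    (Omega : measurableType disp) (P : probability Omega R)
    (N d : nat) (hN : (0 < N)%N) (hd : (0 < d)%N)
    (H : 'rV[R]_N) (hH : forall k, 0 < H 0 k < 1)
    (hmin : 1 / 4 < min_hurst H)
    (a : 'rV[R]_N) (ha : a != 0)
    (B : 'I_N -> 'I_d -> R -> {RV P >-> R}) (hB : fbm_family H B)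
    (T : R) (hT : 0 < T)
    (p : R) (hp : 1 / min_hurst H < p)
    (MM : Omega -> R -> R -> tseries R d)
    (hMM : geometric_rough_path_above P p T (mixed_fbm a B) MM) :
  {ae P, forall omega, exists S : R -> R -> tseries R d,
    (* S is the signature of MM: Lyons' extension, which is unique *)
    [/\ lyons_extension p T (MM omega) S,
        forall S', lyons_extension p T (MM omega) S' ->
          forall s t, 0 <= s -> s <= t -> t <= T -> S' s t = S s t &
    (* convergence in p-variation: of the signatures of the interpolations, at
       every level, and of the series defining S *)
    [/\ forall n, rp_dist p T n
          (iter_int (dyadic_interp T m (mixed_fbm a B omega))) S
          @[m --> \oo] --> 0%E,
        (\sum_(1 <= n <oo) pvar p T n S < +oo)%E,
        forall s t, 0 <= s -> s <= t -> t <= T -> group_like (S s t) &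
        forall s t u, 0 <= s -> s <= t -> t <= u -> u <= T ->
          S s u = tprod (S s t) (S t u)]]}.
Proof.
(* [min_hurst H] never exceeds its default value 1. *)
have p1 : 1 < p.
  apply: le_lt_trans hp; rewrite ler_pdivlMr ?mul1r ?min_hurst_le1//.
  by apply: lt_trans hmin.
have p0 : 0 < p := lt_trans ltr01 p1.
apply: filterS hMM => omega [Znil Zdiag XZ].
set X := fun m => iter_int (dyadic_interp T m (mixed_fbm a B omega)) in XZ *.
have /choice[L XL] : forall m, exists L, lipschitz_mf T L (X m).
  by move=> m; exact: dyadic_interp_lipschitz.
have [M [M0 XM]] := uniform_extension_estimate hT p1 XL XZ.
have Smult := limit_functional_multiplicative p1 XL M0 XM.
have Spvar k := limit_functional_pvar p1 XL M0 XM (k := k).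
have Sext : lyons_extension p T (MM omega) (limit_functional X).
  split=> // [k k0|s t w s0 st tT wp].
    by apply: le_lt_trans (Spvar k k0) _; exact: ltry.
  case: w wp => [|i w] wp; first by rewrite Znil//; have [-> //] := Smult.
  (* On [t, t] the distance gives no information; agreement there comes from the normalisation of
     [MM]. *)
  move: st tT; rewrite le_eqVlt => /orP[/eqP <-|st] tT; apply: cvg_lim => //.
    rewrite Zdiag// /tunit /=; under eq_fun do rewrite (lmf_diag (XL _))//.
    exact: cvg_cst.
  exact: (rp_dist_pointwise_cvg p0 XZ s0 st tT (w := i :: w)) wp.
exists (limit_functional X); split; [exact: Sext| |].
  by move=> S' S'ext s t; exact: (lyons_extension_unique p0 hT Sext S'ext).
split.
- exact: (limit_functional_rp_dist p1 XL M0 XM).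
- exact: (pvar_summable hT p1 M0 Spvar).
- by move=> s t; exact: (limit_functional_group_like p1 XL M0 XM).
- by have [_ chen _] := Smult.
Qed.
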